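(* Let $1\le q<\infty$, $w=(w_k)$ a nonincreasing sequence of positive numbers, and $1\le p\le\infty$. The following are equivalent: (i) $\ell^p$ is symmetrically block finitely represented in the unit vector basis $\{e_k\}$ of $\lambda_q(w)$; (ii) $\ell^p$ is symmetrically finitely represented in $\lambda_q(w)$; (iii) $\ell^p$ is crudely symmetrically finitely represented in $\lambda_q(w)$; (iv) $p\in[1/\beta,1/\alpha]$ (with $1/0=\infty$), where $$\alpha=-\lim_{n\to\infty}\frac1n\log_2\sup_{j\in\mathbb N}\Big(\frac{\sum_{k=1}^jw_k^q}{\sum_{k=1}^{2^nj}w_k^q}\Big)^{1/q},\qquad \beta=\lim_{n\to\infty}\frac1n\log_2\sup_{j\in\mathbb N}\Big(\frac{\sum_{k=1}^{2^nj}w_k^q}{\sum_{k=1}^jw_k^q}\Big)^{1/q}.$$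
   Context: $\lambda_q(w)$ is the Lorentz space of real sequences $a$ with $\|a\|_{\lambda_q(w)}=(\sum_{k=1}^\infty(a^*_k)^qw_k^q)^{1/q}<\infty$, $a^*$ the nonincreasing rearrangement of $(|a_k|)$. Sequences $x,y$ have the same ordered distribution if $y_{\pi(k)}=x_k$ for some permutation $\pi$ of $\mathbb N$; finite blocks $\sum_{i=1}^m\alpha_ie_{n_i}$, $\sum_{i=1}^m\beta_ie_{k_i}$ (increasing indices) have the same ordered distribution if $\beta_i=\alpha_{\pi(i)}$ for a permutation $\pi$ of $\{1,\dots,m\}$. $\|a\|_p$ is the $\ell^p$ norm on $\mathbb R^n$ (max norm if $p=\infty$). In a space $X$: $\ell^p$ is symmetrically block finitely represented in $\{e_k\}$ if for all $n,\varepsilon>0$ there are $0=m_0<\dots<m_n$ and reals $\alpha_i$ such that the blocks $u_k=\sum_{i=m_{k-1}+1}^{m_k}\alpha_ie_i$ pairwise have the same ordered distribution and $(1+\varepsilon)^{-1}\|a\|_p\le\|\sum a_ku_k\|_X\le(1+\varepsilon)\|a\|_p$ for all $a\in\mathbb R^n$; symmetrically finitely represented if for all $n,\varepsilon>0$ there are pairwise disjointly supported $x_1,\dots,x_n\in X$ pairwise with the same ordered distribution satisfying the same $(1+\varepsilon)$ estimate; crudely symmetrically finitely represented if for some $C>0$ and every $n$ such $x_k$ exist with $C^{-1}\|a\|_p\le\|\sum a_kx_k\|_X\le C\|a\|_p$. *)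

(* Defs.v *)
From HB Require Import structures.
From mathcomp Require Import all_boot all_order all_algebra.
From mathcomp Require Import perm.
From mathcomp Require Import all_classical all_reals all_analysis.
Set Implicit Arguments. Unset Strict Implicit. Unset Printing Implicit Defensive.
Import Order.TTheory GRing.Theory Num.Theory.
Import numFieldNormedType.Exports.
Local Open Scope classical_set_scope.
Local Open Scope ring_scope.

(* Convention: sequences are indexed from 0, i.e. the paper's a_k (k>=1)
   is [a (k-1)], and the paper's unit vector e_k is the indicator of k-1. *)

Section Lorentz.
Context {R : realType}.

(* nonincreasing rearrangement of (|a_i|): the paper's a*_{k+1} is
   [decr a k] = inf { s >= 0 : #{ i : |a i| > s } <= k }  (value in \bar R) *)
Definition decr (a : nat -> R) (k : nat) : \bar R :=
  ereal_inf [set s%:E | s in [set s : R | 0 <= s /\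
     (forall F : seq nat, uniq F -> all (fun i => s < `|a i|) F ->
        (size F <= k)%N)]].

Definition lnorm (q : R) (w : nat -> R) (a : nat -> R) : \bar R :=
  poweR (\sum_(k <oo) poweR (decr a k * (w k)%:E)%E q)%E q^-1.

Definition in_lambda (q : R) (w : nat -> R) (a : nat -> R) : Prop :=
  (lnorm q w a < +oo)%E.

Definition lpnorm (n : nat) (p : \bar R) (a : 'I_n -> R) : R :=
  match p with
  | +oo%E => \big[Num.max/0]_(i < n) `|a i|
  | r%:E => powR (\sum_(i < n) powR `|a i| r) r^-1
  | -oo%E => 0
  end.

Definition lincomb (n : nat) (a : 'I_n -> R) (x : 'I_n -> nat -> R) : nat -> R :=
  fun i => \sum_(k < n) a k * x k i.

Definition same_dist (x y : nat -> R) : Prop :=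
  exists pi : nat -> nat, bijective pi /\ forall k, y (pi k) = x k.

Definition block (m : nat -> nat) (alpha : nat -> R) (k : nat) : nat -> R :=
  fun i => if (m k <= i < m k.+1)%N then alpha i else 0.

Definition block_coefs (m : nat -> nat) (alpha : nat -> R) (k : nat) : seq R :=
  [seq alpha i | i <- iota (m k) (m k.+1 - m k)].

Definition same_block_dist (s t : seq R) : Prop :=
  size t = size s /\
    exists pi : {perm 'I_(size s)},
      forall i : 'I_(size s), nth 0 t i = nth 0 s (pi i).

Definition sym_block_fin_rep (q : R) (w : nat -> R) (p : \bar R) : Prop :=
  forall (n : nat) (eps : R), 0 < eps ->
  exists (m : nat -> nat) (alpha : nat -> R),
    [/\ m 0%N = 0%N,
        (forall k, (k < n)%N -> (m k < m k.+1)%N),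
        (forall k l, (k < n)%N -> (l < n)%N ->
           same_block_dist (block_coefs m alpha k) (block_coefs m alpha l)) &
        (forall a : 'I_n -> R,
           ((1 + eps)^-1 * lpnorm p a)%:E
             <= lnorm q w (lincomb a (fun k => block m alpha k)) /\
           lnorm q w (lincomb a (fun k => block m alpha k))
             <= ((1 + eps) * lpnorm p a)%:E)%E].

Definition sym_system (q : R) (w : nat -> R) (n : nat) (x : 'I_n -> nat -> R) : Prop :=
  [/\ (forall k, in_lambda q w (x k)),
      (forall k l, k != l -> forall i, x k i = 0 \/ x l i = 0) &
      (forall k l, same_dist (x k) (x l))].

Definition sym_fin_rep (q : R) (w : nat -> R) (p : \bar R) : Prop :=
  forall (n : nat) (eps : R), 0 < eps ->
  exists x : 'I_n -> nat -> R, sym_system q w x /\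
    (forall a : 'I_n -> R,
       ((1 + eps)^-1 * lpnorm p a)%:E <= lnorm q w (lincomb a x) /\
       lnorm q w (lincomb a x) <= ((1 + eps) * lpnorm p a)%:E)%E.

Definition crude_sym_fin_rep (q : R) (w : nat -> R) (p : \bar R) : Prop :=
  exists C : R, 0 < C /\ forall n : nat,
  exists x : 'I_n -> nat -> R, sym_system q w x /\
    (forall a : 'I_n -> R,
       (C^-1 * lpnorm p a)%:E <= lnorm q w (lincomb a x) /\
       lnorm q w (lincomb a x) <= (C * lpnorm p a)%:E)%E.

Definition log2 (x : R) : R := ln x / ln 2.

Definition Wsum (q : R) (w : nat -> R) (j : nat) : R :=
  \sum_(0 <= k < j) powR (w k) q.

Definition alpha_seq (q : R) (w : nat -> R) (n : nat) : R :=
  n%:R^-1 * log2 (sup [set powR (Wsum q w j / Wsum q w (2 ^ n * j)) q^-1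
                       | j in [set j : nat | (0 < j)%N]]).

Definition beta_seq (q : R) (w : nat -> R) (n : nat) : R :=
  n%:R^-1 * log2 (sup [set powR (Wsum q w (2 ^ n * j) / Wsum q w j) q^-1
                       | j in [set j : nat | (0 < j)%N]]).

Definition alpha_idx (q : R) (w : nat -> R) : R := - limn (alpha_seq q w).

Definition beta_idx (q : R) (w : nat -> R) : R := limn (beta_seq q w).

Definition einv (x : R) : \bar R := if x == 0 then +oo%E else (x^-1)%:E.

End Lorentz.

(* Main.v *)
(** Write [W j] for the sum of the first [j] values of [w^q] and [g i = 2^(-i q/p) W (2^i)].

    (iii) => (iv): a sum [z] of [2^m] disjoint copies of [x] satisfies
    [decr z k = decr x (k %/ 2^m)], so summation by parts bounds the norm of [z]
    above and below by that of [x] times the suprema defining [beta] and [alpha].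

    (iv) => (i), [p] finite: the blocks are the values [k^(-1/p)] for
    [M < k <= N]. Counting the entries of [sum a_k u_k] above a level [s] shows
    that its distribution function is that of [u] with [s] replaced by
    [s / ||a||_p], up to truncation at both ends; truncation costs
    [O(g(log M) + g(log N))] in the [q]-th power of the norm, against the mass
    [sum_{M < k <= N} k^(-q/p) w_k^q]. So it suffices to find dyadic windows whose
    mass dominates the values of [g] at both ends. If there were none, [g] would
    grow geometrically (then [alpha > 1/p]) or decay geometrically (then
    [beta < 1/p]). For [p = +oo], submultiplicativity and [alpha = 0] force every
    [sup_j W j / W (2^m j)] to be 1, and constant blocks work. *)
Require Import Defs.
From HB Require Import structures.
From mathcomp Require Import all_boot all_order all_algebra.
From mathcomp Require Import perm.
From mathcomp Require Import all_classical all_reals all_analysis.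
From mathcomp Require Import ring lra zify.
Set Implicit Arguments. Unset Strict Implicit. Unset Printing Implicit Defensive.
Import Order.TTheory GRing.Theory Num.Theory.
Import numFieldNormedType.Exports.
Local Open Scope ring_scope.

(** * The indices alpha and beta *)

Section Fekete.
Context (R : realType).
Implicit Types u : nat -> R.

Lemma subadditive_mulnD u k m r :
  (forall i j, u (i + j)%N <= u i + u j) -> u (k * m + r)%N <= k%:R * u m + u r.
Proof.
move=> uD; elim: k => [|k IH]; first by rewrite mul0n add0n mul0r add0r.
by rewrite mulSn -addnA (le_trans (uD _ _))// -natr1 mulrDl mul1r [_ + u m]addrC
  -addrA lerD2l.
Qed.

(** Euclidean division of n by m: the quotient contributes copies of [u m], and the remainder takes
    only finitely many values. *)
Lemma subadditive_upper u m : (forall i j, u (i + j)%N <= u i + u j) ->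
  (0 < m)%N -> exists K, forall n, u n <= n%:R * (m%:R^-1 * u m) + K.
Proof.
(* The term in [u m] pays for replacing [n %/ m] by n / m; the sum bounds [u] at the remainder. *)
move=> uD m0; exists (`|u m| + \sum_(i < m) `|u i|) => n.
rewrite {1}(divn_eq n m) (le_trans (subadditive_mulnD _ _ _ uD))//.
have rm : (n %% m < m)%N by rewrite ltn_mod.
have ur : u (n %% m)%N <= \sum_(i < m) `|u i|.
  by rewrite (le_trans (ler_norm _))// (bigD1 (Ordinal rm))//= lerDl sumr_ge0.
have mR : 0 < m%:R :> R by rewrite ltr0n.
have -> : n%:R = (n %/ m)%:R * m%:R + (n %% m)%:R :> R.
  by rewrite -natrM -natrD -divn_eq.
rewrite addrA lerD// mulrDl mulrA mulfK ?gt_eqF// -addrA lerDl mulrA.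
have le1 : (n %% m)%:R * m%:R^-1 <= 1 :> R.
  by rewrite ler_pdivrMr// mul1r ler_nat ltnW.
have ge0 : 0 <= (n %% m)%:R * m%:R^-1 :> R by rewrite divr_ge0.
have := ler_norm (- u m); rewrite normrN => h.
have h2 := ler_wpM2r (normr_ge0 (u m)) le1.
have := ler_wpM2l ge0 h; lra.
Qed.

(** Fekete's lemma. The limit is the infimum of the quotients, which the linear lower bound keeps
    finite; that it lies below every term is what later makes alpha = 0 so restrictive. *)
Lemma fekete u C : (forall i j, u (i + j)%N <= u i + u j) ->
  (forall n, - (C * n%:R) <= u n) ->
  exists2 l, ((fun n => n%:R^-1 * u n) @ \oo --> l)%classic &
    forall n, (0 < n)%N -> l <= n%:R^-1 * u n.
Proof.
move=> uD uC; pose S := [set n%:R^-1 * u n | n in [set n : nat | (0 < n)%N]]%classic.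
have lbS : has_lbound S.
  exists (- C) => _ [n /= n0 <-].
  by rewrite mulrC ler_pdivlMr ?ltr0n// mulNr.
have S0 : (S !=set0)%classic by exists (1%:R^-1 * u 1%N), 1%N.
exists (inf S); last by move=> n n0; apply: ge_inf => //; exists n.
apply/cvgrPdist_le => e e0.
have e20 : 0 < e / 2 by rewrite divr_gt0.
have [_ [m /= m0 <-] mS] := inf_adherent e20 (conj S0 lbS).
have [K uK] := subadditive_upper uD m0.
near=> n.
have n0 : (0 < n)%N by near: n; exact: nbhs_infty_gt.
have nR : 0 < n%:R :> R by rewrite ltr0n.
have Kn : K / (e / 2) <= n%:R by near: n; exact: nbhs_infty_ger.
have Sn : inf S <= n%:R^-1 * u n by apply: ge_inf => //; exists n.
rewrite distrC ger0_norm ?subr_ge0// lerBlDl mulrC ler_pdivrMr//.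
rewrite (le_trans (uK n))// mulrC.
move: Kn; rewrite ler_pdivrMr// => Kn.
have := ler_wpM2r (ltW nR) (ltW mS); lra.
Unshelve. all: by end_near. Qed.

(** The additive constant and the starting rank disappear in the limit. Constants of this kind arise
    as logarithms of multiplicative ones. *)
Lemma cvg_linear_ge u l x c n0 : ((fun n => n%:R^-1 * u n) @ \oo --> l)%classic ->
  (forall n, (n0 <= n)%N -> c + x * n%:R <= u n) -> x <= l.
Proof.
move=> ul h; apply/ler_addgt0Pr => e e0; rewrite -lerBlDr.
apply: (cvgr_to_ge ul); near=> n.
have nR : 0 < n%:R :> R by rewrite ltr0n; near: n; exact: nbhs_infty_gt.
have Kn : (- c) / e <= n%:R by near: n; exact: nbhs_infty_ger.
rewrite mulrC ler_pdivlMr//; apply: le_trans (h n _).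
  by move: Kn; rewrite ler_pdivrMr//; lra.
by near: n; exact: nbhs_infty_ge.
Unshelve. all: by end_near. Qed.

Lemma cvg_linear_le u l x c n0 : ((fun n => n%:R^-1 * u n) @ \oo --> l)%classic ->
  (forall n, (n0 <= n)%N -> u n <= c + x * n%:R) -> l <= x.
Proof.
move=> ul h; rewrite -lerN2.
apply: (@cvg_linear_ge (fun n => - u n) _ _ (- c) n0).
  by under eq_fun do rewrite mulrN; exact: cvgN.
by move=> n /h; lra.
Qed.

End Fekete.

Section Log2.
Context (R : realType).
Implicit Types x y : R.

Lemma ln2_gt0 : 0 < ln (2 : R). Proof. by rewrite ln_gt0// ltr1n. Qed.

Lemma log2M x y : 0 < x -> 0 < y -> log2 (x * y) = log2 x + log2 y.
Proof. by move=> x0 y0; rewrite /log2 lnM ?posrE// mulrDl. Qed.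

Lemma ler_log2 x y : 0 < x -> x <= y -> log2 x <= log2 y.
Proof.
move=> x0 xy; rewrite ler_pM2r ?invr_gt0 ?ln2_gt0// ler_ln ?posrE//.
exact: lt_le_trans xy.
Qed.

Lemma log2_pow2 x : log2 (powR 2 x) = x.
Proof. by rewrite /log2 ln_powR mulfK// gt_eqF// ln2_gt0. Qed.

Lemma log2_1 : log2 (1 : R) = 0. Proof. by rewrite /log2 ln1 mul0r. Qed.

Lemma log2K x : 0 < x -> powR 2 (log2 x) = x.
Proof.
move=> x0; rewrite /powR pnatr_eq0/= /log2 divfK ?gt_eqF ?ln2_gt0//.
by rewrite lnK ?posrE.
Qed.

End Log2.

Section Indices.
Context (R : realType) (q : R) (w : nat -> R).
Context (q1 : 1 <= q) (w0 : forall k, 0 < w k) (wS : forall k, w k.+1 <= w k).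

Local Notation v k := (powR (w k) q).
Local Notation W := (Wsum q w).

Let q0 : 0 < q. Proof. by apply: lt_le_trans q1. Qed.
Let q'0 : 0 <= q^-1. Proof. by rewrite invr_ge0 ltW. Qed.

Let pow1 : powR 1 q^-1 = 1 :> R. Proof. by rewrite powR1. Qed.

Lemma weight_gt0 k : 0 < v k. Proof. exact: powR_gt0. Qed.

Lemma weight_homo m n : (m <= n)%N -> v n <= v m.
Proof.
move=> mn; apply: ge0_ler_powR; rewrite ?nnegrE; [exact: ltW..|].
elim: n mn => [|n IH]; first by rewrite leqn0 => /eqP->.
by rewrite leq_eqVlt => /predU1P[->//|]; rewrite ltnS => /IH; exact: le_trans (wS n).
Qed.

Lemma Wsum0 : W 0 = 0. Proof. by rewrite /Wsum big_geq. Qed.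

Lemma WsumS j : W j.+1 = W j + v j.
Proof. by rewrite /Wsum big_nat_recr. Qed.

Lemma Wsum_homo i j : (i <= j)%N -> W i <= W j.
Proof.
elim: j => [|j IH]; first by rewrite leqn0 => /eqP->.
rewrite leq_eqVlt => /predU1P[->//|]; rewrite ltnS => /IH /le_trans-> //.
by rewrite WsumS lerDl ltW// weight_gt0.
Qed.

Lemma Wsum_ge0 j : 0 <= W j.
Proof. by rewrite -Wsum0 Wsum_homo. Qed.

Lemma Wsum_gt0 j : (0 < j)%N -> 0 < W j.
Proof. by case: j => // j _; rewrite WsumS ltr_wpDl ?Wsum_ge0 ?weight_gt0. Qed.

Lemma WsumD_le i j : W (i + j) <= W i + W j.
Proof.
elim: j => [|j IH]; first by rewrite addn0 Wsum0 addr0.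
by rewrite addnS !WsumS addrA lerD// weight_homo ?leq_addl.
Qed.

Lemma WsumM_le n j : W (n * j) <= n%:R * W j.
Proof.
elim: n => [|n IH]; first by rewrite mul0n Wsum0 mul0r.
by rewrite mulSn (le_trans (WsumD_le _ _))// -natr1 mulrDl mul1r addrC lerD2r.
Qed.

(** The suprema are those inside [alpha_seq] and [beta_seq]; written [A m] and [B m] below, they
    control how repeating each value of a rearrangement 2^m times changes the norm. *)
Definition Aset m := [set powR (W j / W (2 ^ m * j)) q^-1
                     | j in [set j : nat | (0 < j)%N]]%classic.
Definition Bset m := [set powR (W (2 ^ m * j) / W j) q^-1
                     | j in [set j : nat | (0 < j)%N]]%classic.

Lemma dyadic_gt0 m j : (0 < j)%N -> (0 < 2 ^ m * j)%N.
Proof. by move=> j0; rewrite muln_gt0 expn_gt0. Qed.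
Local Hint Resolve dyadic_gt0 : core.

Lemma Aset_le1 m : ubound (Aset m) 1.
Proof.
move=> _ [j /= j0 <-]; rewrite -pow1.
apply: ge0_ler_powR; rewrite ?nnegrE ?divr_ge0 ?Wsum_ge0//.
rewrite ler_pdivrMr ?Wsum_gt0// ?mul1r ?Wsum_homo ?leq_pmull ?expn_gt0//.
exact: dyadic_gt0.
Qed.

Lemma Bset_le m : ubound (Bset m) (powR (2 ^+ m) q^-1).
Proof.
move=> _ [j /= j0 <-].
apply: ge0_ler_powR; rewrite ?nnegrE ?divr_ge0 ?Wsum_ge0 ?exprn_ge0//.
by rewrite ler_pdivrMr ?Wsum_gt0// -natrX WsumM_le.
Qed.

Lemma Aset_has_sup m : has_sup (Aset m).
Proof.
split; last by exists 1; exact: Aset_le1.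
by exists (powR (W 1 / W (2 ^ m * 1)) q^-1), 1%N.
Qed.

Lemma Bset_has_sup m : has_sup (Bset m).
Proof.
split; last by exists (powR (2 ^+ m) q^-1); exact: Bset_le.
by exists (powR (W (2 ^ m * 1) / W 1) q^-1), 1%N.
Qed.

Local Notation A m := (sup (Aset m)).
Local Notation B m := (sup (Bset m)).

Lemma Aset_ub m j : (0 < j)%N -> powR (W j / W (2 ^ m * j)) q^-1 <= A m.
Proof. by move=> j0; apply: ub_le_sup; [exact: (Aset_has_sup m).2|exists j]. Qed.

Lemma Bset_ub m j : (0 < j)%N -> powR (W (2 ^ m * j) / W j) q^-1 <= B m.
Proof. by move=> j0; apply: ub_le_sup; [exact: (Bset_has_sup m).2|exists j]. Qed.

Lemma Asup_gt0 m : 0 < A m.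
Proof.
apply: lt_le_trans (Aset_ub m (ltn0Sn 0)); apply: powR_gt0.
by rewrite divr_gt0 ?Wsum_gt0// dyadic_gt0.
Qed.

Lemma Bsup_ge1 m : 1 <= B m.
Proof.
apply: le_trans (Bset_ub m (ltn0Sn 0)); rewrite -pow1.
apply: ge0_ler_powR; rewrite ?nnegrE ?divr_ge0 ?Wsum_ge0//.
by rewrite ler_pdivlMr ?Wsum_gt0// ?mul1r ?Wsum_homo ?leq_pmull ?expn_gt0.
Qed.

Lemma Asup_le1 m : A m <= 1.
Proof. by apply: ge_sup; [exact: (Aset_has_sup m).1|exact: Aset_le1]. Qed.

(** The bound by the supremum, with root and quotient cleared. It covers j = 0, where both sides
    vanish, because summation by parts starts there. *)
Lemma Wsum_Asup m j : W j <= powR (A m) q * W (2 ^ m * j).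
Proof.
have [->|j0] := posnP j; first by rewrite muln0 Wsum0 mulr0.
have W2 := Wsum_gt0 (dyadic_gt0 m j0).
rewrite -ler_pdivrMr// -[leLHS](powRr1 (divr_ge0 (Wsum_ge0 _) (Wsum_ge0 _))).
rewrite -(mulVf (lt0r_neq0 q0)) powRrM.
by apply: ge0_ler_powR; rewrite ?nnegrE ?powR_ge0 ?(ltW q0) ?Aset_ub// ltW ?Asup_gt0.
Qed.

Lemma Wsum_Bsup m j : W (2 ^ m * j) <= powR (B m) q * W j.
Proof.
have [->|j0] := posnP j; first by rewrite muln0 Wsum0 mulr0.
rewrite -ler_pdivrMr ?Wsum_gt0// -[leLHS](powRr1 (divr_ge0 (Wsum_ge0 _) (Wsum_ge0 _))).
rewrite -(mulVf (lt0r_neq0 q0)) powRrM.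
apply: ge0_ler_powR; rewrite ?nnegrE ?powR_ge0 ?(ltW q0)  ?Bset_ub//.
exact: le_trans (Bsup_ge1 m).
Qed.

Lemma Asup_le m c : 0 < c -> (forall j, (0 < j)%N -> W j <= c * W (2 ^ m * j)) ->
  A m <= powR c q^-1.
Proof.
move=> c0 h; apply: ge_sup; first exact: (Aset_has_sup m).1.
move=> _ [j /= j0 <-]; apply: ge0_ler_powR; rewrite ?nnegrE ?divr_ge0 ?Wsum_ge0 ?(ltW c0)//.
by rewrite ler_pdivrMr ?Wsum_gt0 ?dyadic_gt0// h.
Qed.

Lemma Bsup_le m c : 0 < c -> (forall j, (0 < j)%N -> W (2 ^ m * j) <= c * W j) ->
  B m <= powR c q^-1.
Proof.
move=> c0 h; apply: ge_sup; first exact: (Bset_has_sup m).1.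
move=> _ [j /= j0 <-]; apply: ge0_ler_powR; rewrite ?nnegrE ?divr_ge0 ?Wsum_ge0 ?(ltW c0)//.
by rewrite ler_pdivrMr ?Wsum_gt0// h.
Qed.

Lemma powR_qK x : 0 <= x -> powR (powR x q) q^-1 = x.
Proof. by move=> x0; rewrite -powRrM mulfV ?gt_eqF// powRr1. Qed.

(** Pass through the intermediate length 2^m * j. Submultiplicativity makes the logarithms
    subadditive, as [fekete] requires. *)
Lemma AsupD m n : A (m + n) <= A m * A n.
Proof.
have Am := Asup_gt0 m; have An := Asup_gt0 n.
rewrite -[leRHS]powR_qK ?mulr_ge0 ?(ltW Am) ?(ltW An)//; apply: Asup_le.
  by rewrite powR_gt0 ?mulr_gt0.
move=> j j0; rewrite powRM ?(ltW Am) ?(ltW An)// -mulrA (le_trans (Wsum_Asup m j))//.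
rewrite ler_wpM2l ?powR_ge0// (le_trans (Wsum_Asup n _))//.
by rewrite mulnA -expnD addnC.
Qed.

Lemma BsupD m n : B (m + n) <= B m * B n.
Proof.
have Bm := lt_le_trans ltr01 (Bsup_ge1 m); have Bn := lt_le_trans ltr01 (Bsup_ge1 n).
rewrite -[leRHS]powR_qK ?mulr_ge0 ?(ltW Bm) ?(ltW Bn)//; apply: Bsup_le.
  by rewrite powR_gt0 ?mulr_gt0.
move=> j j0; rewrite powRM ?(ltW Bm) ?(ltW Bn)// -mulrA expnD -mulnA (le_trans (Wsum_Bsup m _))//.
by rewrite ler_wpM2l ?powR_ge0// (Wsum_Bsup n _).
Qed.

(** Subadditivity of [W] at j = 1 gives the linear lower bound that keeps Fekete's limit finite. *)
Lemma Asup_ge m : powR 2 (- q^-1 * m%:R) <= A m.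
Proof.
have -> : - q^-1 * m%:R = m%:R * (- 1) * q^-1 by ring.
rewrite powRrM powRrM powR_mulrn// powR_inv1 ?exprn_ge0//.
apply: le_trans (Aset_ub m (ltn0Sn 0)).
apply: ge0_ler_powR; rewrite ?nnegrE ?divr_ge0 ?Wsum_ge0 ?invr_ge0 ?exprn_ge0 ?(ltW q0)//.
rewrite ler_pdivlMr ?Wsum_gt0 ?dyadic_gt0// mulrC ler_pdivrMr ?exprn_gt0//.
by rewrite mulrC -natrX WsumM_le.
Qed.

Lemma alpha_cvg : exists2 l, (alpha_seq q w @ \oo --> l)%classic &
  (alpha_idx q w = - l /\ forall n, (0 < n)%N -> l <= n%:R^-1 * log2 (A n)).
Proof.
have [] := @fekete R (fun n => log2 (A n)) q^-1.
- by move=> i j; rewrite -log2M ?Asup_gt0// ler_log2 ?Asup_gt0 ?AsupD.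
- move=> n; rewrite -mulNr -[leLHS]log2_pow2; apply: ler_log2; last exact: Asup_ge.
  by rewrite powR_gt0.
- move=> l ul lu; exists l => //; split=> //.
  by rewrite /alpha_idx; congr (- _); exact: cvg_lim ul.
Qed.

Lemma beta_cvg : (beta_seq q w @ \oo --> beta_idx q w)%classic.
Proof.
have B0 n := lt_le_trans ltr01 (Bsup_ge1 n).
have [] := @fekete R (fun n => log2 (B n)) 0.
- by move=> i j; rewrite -log2M// ler_log2 ?BsupD.
- by move=> n; rewrite mul0r oppr0 -log2_1 ler_log2 ?Bsup_ge1.
- by move=> l ul lu; rewrite /beta_idx (cvg_lim _ ul).
Qed.

Lemma alpha_ge0 : 0 <= alpha_idx q w.
Proof.
have [l ul [-> _]] := alpha_cvg; rewrite oppr_ge0.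
apply: (@cvg_linear_le R _ _ _ 0 0 ul) => n _.
by rewrite mul0r addr0 -log2_1 ler_log2 ?Asup_gt0 ?Asup_le1.
Qed.

Lemma beta_ge0 : 0 <= beta_idx q w.
Proof.
apply: (@cvg_linear_ge R _ _ _ 0 0 beta_cvg) => n _.
by rewrite mul0r addr0 -log2_1 ler_log2 ?Bsup_ge1.
Qed.

(** Fekete's limit -alpha is a lower bound for log2 (A m) / m at every positive m, so alpha = 0
    leaves no room below 1; m = 0 is computed directly. *)
Lemma alpha_eq0 m : alpha_idx q w = 0 -> 1 <= A m.
Proof.
have [l ul [-> lu]] := alpha_cvg => /eqP; rewrite oppr_eq0 => /eqP l0.
have [->|m0] := posnP m.
  apply: le_trans (Aset_ub 0 (ltn0Sn 0)).
  by rewrite expn0 mul1n divff ?powR1// gt_eqF// Wsum_gt0.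
have := lu _ m0; rewrite l0 mulrC ler_pdivlMr ?ltr0n// mul0r => h.
by rewrite -[leRHS]log2K ?Asup_gt0// -[leLHS](powRr0 2) ler_powR// ler1n.
Qed.

(** After division by n the factor [c] contributes log2 c / n, which tends to 0: an index sees only
    the exponential rate. The three lemmas that follow work alike. *)
Lemma alpha_le_of c x : 0 < c -> (forall m, c * powR 2 (- x * m%:R) <= A m) ->
  alpha_idx q w <= x.
Proof.
move=> c0 h; have [l ul [-> _]] := alpha_cvg; rewrite lerNl.
apply: (@cvg_linear_ge R _ _ _ (log2 c) 0 ul) => n _.
by rewrite -(log2_pow2 (- x * _)) -log2M ?powR_gt0// ler_log2 ?mulr_gt0 ?powR_gt0.
Qed.

Lemma alpha_ge_of c x m0 : 0 < c ->
  (forall m, (m0 <= m)%N -> A m <= c * powR 2 (- x * m%:R)) -> x <= alpha_idx q w.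
Proof.
move=> c0 h; have [l ul [-> _]] := alpha_cvg; rewrite lerNr.
apply: (@cvg_linear_le R _ _ _ (log2 c) m0 ul) => n /h An.
by rewrite -(log2_pow2 (- x * _)) -log2M ?powR_gt0// ler_log2 ?Asup_gt0.
Qed.

Lemma beta_ge_of c x : 0 < c -> (forall m, c * powR 2 (x * m%:R) <= B m) ->
  x <= beta_idx q w.
Proof.
move=> c0 h; apply: (@cvg_linear_ge R _ _ _ (log2 c) 0 beta_cvg) => n _.
by rewrite -(log2_pow2 (x * _)) -log2M ?powR_gt0// ler_log2 ?mulr_gt0 ?powR_gt0.
Qed.

Lemma beta_le_of c x m0 : 0 < c ->
  (forall m, (m0 <= m)%N -> B m <= c * powR 2 (x * m%:R)) -> beta_idx q w <= x.
Proof.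
move=> c0 h; apply: (@cvg_linear_le R _ _ _ (log2 c) m0 beta_cvg) => n /h Bn.
rewrite -(log2_pow2 (x * _)) -log2M ?powR_gt0// ler_log2//.
exact: lt_le_trans (Bsup_ge1 n).
Qed.

End Indices.

(** * Windows of large power mass *)

Section Dichotomy.
Context (R : realType).

(* If the sum of [g] over a window never dominates the values of [g] at both
   ends, the partial sums of [g] from 0 (when they diverge) or its tails (when
   they converge) satisfy a linear recursion, hence are geometric. *)
Lemma geometric_dichotomy (g : nat -> R) (K th : R) : 1 < K -> 0 < th <= 1 ->
  (forall i, 0 < g i) -> (forall i, th * g i <= g i.+1) ->
  (forall a b, (a < b)%N -> \sum_(a <= i < b) g i <= K * (g a + g b)) ->
  (exists c rho n0, [/\ 0 < c, 1 < rho &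
     forall i n, (n0 <= n)%N -> c * rho ^+ n * g i <= g (i + n)%N]) \/
  (exists c rho, [/\ 0 < c, 0 < rho < 1 &
     forall i n, g (i + n)%N <= c * rho ^+ n * g i]).
Proof.
move=> K1 /andP[th0 th1] g0 gth gK; have K0 : 0 < K by lra.
pose S b := \sum_(0 <= i < b) g i.
have SS b : S b.+1 = S b + g b by rewrite /S big_nat_recr.
have S00 : S 0%N = 0 by rewrite /S big_geq.
have Shomo : {homo S : a b / (a <= b)%N >-> a <= b}.
  by apply: homo_leq => // [? ? ?|i]; [exact: le_trans|rewrite SS lerDl ltW].
(* Once [S b] reaches twice K * g 0, the left-end term in [gK] is absorbed and the right end alone
   controls [S b]. Otherwise the partial sums are bounded. *)
have [[b0 Sb0]|Sbd] := pselect (exists b, 2 * K * g 0%N <= S b); [left|right].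
  have b00 : (0 < b0)%N.
    case: b0 Sb0 => //; rewrite S00 => h.
    by have := mulr_gt0 (mulr_gt0 (ltr0Sn R 1) K0) (g0 0%N); lra.
  have SK b : (b0 <= b)%N -> S b <= 2 * K * g b.
    move=> bb0; have := gK 0%N b (leq_trans b00 bb0); have := Shomo _ _ bb0.
    rewrite -/(S b); lra.
  (* By [SK], the increment g b of [S] is at least S b / (2K), which gives this growth ratio. *)
  pose rho := 1 + (2 * K)^-1.
  have rho1 : 1 < rho by rewrite ltrDl invr_gt0 mulr_gt0.
  have Srho b n : (b0 <= b)%N -> rho ^+ n * S b <= S (b + n)%N.
    move=> bb0; elim: n => [|n IH]; first by rewrite mul1r addn0.
    rewrite exprS -mulrA addnS SS (le_trans (ler_wpM2l _ IH)) ?(le_trans ler01 (ltW rho1))//.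
    rewrite mulrDl mul1r lerD2l mulrC ler_pdivrMr ?mulr_gt0// mulrC.
    by apply: SK; rewrite (leq_trans bb0)// leq_addr.
  (* Return from [S] to [g] by g i <= S (i+1) and S (i+n) <= 2K g (i+n); the index shift costs one
     more factor [rho]. *)
  have grho i n : (b0 <= i)%N -> (2 * K * rho)^-1 * rho ^+ n * g i <= g (i + n)%N.
    move=> ib; rewrite -mulrA mulrC ler_pdivrMr ?mulr_gt0//; last by lra.
    have gS : g i <= S i.+1 by rewrite SS lerDr -S00 Shomo.
    have r0 : 0 <= rho by lra.
    case: n => [|n].
      rewrite mul1r addn0 ler_peMr ?(ltW (g0 i))//.
      have : 0 < (2 * K - 1) * rho by rewrite mulr_gt0//; lra.
      lra.
    have := Srho i.+1 n (leqW ib); have := SK (i + n.+1)%N (leq_trans ib (leq_addr _ _)).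
    rewrite addSnnS => h1 h2.
    have := ler_wpM2l (exprn_ge0 n r0) gS => h3.
    rewrite exprS -mulrA; have := le_trans (le_trans h3 h2) h1.
    by move=> /(ler_wpM2l r0)/le_trans; apply; rewrite le_eqVlt; apply/orP; left; apply/eqP; ring.
  (* An index before [b0] is carried up to [b0], losing at most a factor [th] per step. *)
  have gi0 i : (i <= b0)%N -> th ^+ b0 * g i <= g b0.
    move=> ib.
    have H n : th ^+ n * g i <= g (i + n)%N.
      elim: n => [|n IH]; first by rewrite mul1r addn0.
      by rewrite exprS -mulrA addnS (le_trans _ (gth _))// ler_wpM2l// (ltW th0).
    have := H (b0 - i)%N; rewrite subnKC//; apply: le_trans.
    by rewrite ler_wpM2r ?(ltW (g0 i))// ler_wiXn2l ?leq_subr ?(ltW th0).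
  pose c0 := (2 * K * rho)^-1.
  have c00 : 0 < c0 by rewrite invr_gt0 !mulr_gt0//; lra.
  have rho0 : 0 < rho by lra.
  (* Besides [c0], the constant pays for the at most [b0] steps during which no growth is guaranteed
     and for the loss [th ^+ b0] on the way to [b0]. *)
  exists (c0 * (rho ^+ b0)^-1 * th ^+ b0), rho, b0; split => //.
    by apply: mulr_gt0; [apply: mulr_gt0|]; rewrite // ?invr_gt0 ?exprn_gt0.
  move=> i n nb.
  have cle : c0 * (rho ^+ b0)^-1 * th ^+ b0 <= c0.
    rewrite -mulrA ler_piMr ?(ltW c00)// mulr_ile1 ?invr_ge0 ?exprn_ge0 ?(ltW rho0) ?(ltW th0)//.
      by rewrite invf_le1 ?exprn_gt0// exprn_ege1// ltW.
    by rewrite exprn_ile1// (ltW th0).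
  have [ib|/ltnW ib] := leqP b0 i.
    apply: le_trans (grho i n ib); rewrite ler_wpM2r ?(ltW (g0 i))//.
    by rewrite ler_wpM2r ?exprn_ge0 ?(ltW rho0).
  have := grho b0 (i + n - b0)%N (leqnn _).
  rewrite subnKC ?(leq_trans nb) ?leq_addl//; apply: le_trans.
  have := ler_wpM2l (ltW c00) (gi0 _ ib).
  have rn : (rho ^+ b0)^-1 * rho ^+ n <= rho ^+ (i + n - b0).
    rewrite mulrC ler_pdivrMr ?exprn_gt0// -exprD subnK.
      by rewrite ler_weXn2l ?leq_addl// (ltW rho1).
    by rewrite (leq_trans nb) ?leq_addl.
  move=> h; have E : c0 * (rho ^+ b0)^-1 * th ^+ b0 * rho ^+ n * g i =
     ((rho ^+ b0)^-1 * rho ^+ n) * (c0 * (th ^+ b0 * g i)) by ring.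
  rewrite E; apply: (@le_trans _ _ (rho ^+ (i + n - b0) * (c0 * (th ^+ b0 * g i)))).
    apply: ler_wpM2r => //; apply: mulr_ge0 (ltW c00) _.
    by rewrite mulr_ge0 ?exprn_ge0 ?(ltW th0) ?(ltW (g0 i)).
  by rewrite [leRHS]mulrAC [leRHS]mulrC ler_wpM2l// exprn_ge0// ltW.
have SB b : S b <= 2 * K * g 0%N.
  by rewrite leNgt; apply/negP => /ltW h; apply: Sbd; exists b.
pose E := [set S b | b in [set: nat]]%classic.
have Esup : has_sup E.
  by split; [exists (S 0%N), 0%N|exists (2 * K * g 0%N) => _ [b _ <-]].
pose L := sup E.
have SL b : S b <= L by apply: ub_le_sup; [exact: Esup.2|exists b].
(* Let b go to infinity in [gK]: since g b <= L - S b tends to 0, the right-end term drops out and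
   the left end controls the whole tail. *)
have T a : L - S a <= K * g a.
  apply/ler_addgt0Pr => e e0.
  have e'0 : 0 < e / (1 + K) by rewrite divr_gt0//; lra.
  have [_ [b1 _ <-] Lb1] := sup_adherent e'0 Esup.
  have ab : (a < maxn b1 a.+1)%N by rewrite leq_max ltnSn orbT.
  have Sb := Shomo _ _ (leq_maxl b1 a.+1).
  move: (maxn _ _) ab Sb => b ab Sb.
  have gb : g b <= e / (1 + K) by have := SL b.+1; rewrite SS -/L in Lb1 *; lra.
  have := gK _ _ ab.
  have -> : \sum_(a <= i < b) g i = S b - S a.
    have -> : S b = S a + \sum_(a <= i < b) g i by exact: big_cat_nat (leq0n a) (ltnW ab).
    by rewrite addrC addKr.
  have : K * g b + e / (1 + K) <= e.
    apply: le_trans (lerD (ler_wpM2l (ltW K0) gb) (lexx _)) _.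
    rewrite -[X in _ + X]mul1r -mulrDl [K + 1]addrC mulrC divfK//; lra.
  rewrite -/L in Lb1; lra.
(* By [T], passing from a to a + 1 removes g a, at least the fraction 1/K of the tail L - S a. *)
pose rho := 1 - K^-1.
have K'1 : K^-1 < 1 by rewrite invf_lt1.
have K'0 : 0 < K^-1 by rewrite invr_gt0.
have Trho a n : L - S (a + n)%N <= rho ^+ n * (L - S a).
  elim: n => [|n IH]; first by rewrite mul1r addn0.
  rewrite addnS SS exprS -mulrA.
  apply: le_trans (ler_wpM2l _ IH); last by rewrite /rho; lra.
  have := T (a + n)%N; rewrite -ler_pdivrMl// /rho => h; lra.
exists K, rho; split=> //; first by rewrite /rho; apply/andP; split; lra.
move=> i n; have := SL (i + n).+1; rewrite SS => h.
have := Trho i n; have rn : 0 <= rho ^+ n by apply: exprn_ge0; rewrite /rho; lra.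
have := ler_wpM2l rn (T i); rewrite mulrCA -mulrA; lra.
Qed.

End Dichotomy.

Section Window.
Context (R : realType) (q : R) (w : nat -> R).
Context (q1 : 1 <= q) (w0 : forall k, 0 < w k) (wS : forall k, w k.+1 <= w k).

Local Notation v k := (powR (w k) q).
Local Notation W := (Wsum q w).

Let q0 : 0 < q. Proof. exact: lt_le_trans q1. Qed.

Lemma Wsum_cat a b : (a <= b)%N -> W b = W a + \sum_(a <= k < b) v k.
Proof. by move=> ab; exact: big_cat_nat (leq0n a) ab. Qed.

Lemma Wsum_double i : W (2 ^ i.+1) <= 2 * W (2 ^ i).
Proof. by rewrite expnS; exact: WsumM_le. Qed.

(** Rounding j down to a power of 2 changes [W] by a factor at most 2, uniformly over dilations, so
    suprema over all j are governed by dyadic values. *)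
Lemma Wsum_dyadic_bounds j : (0 < j)%N ->
  exists i, [/\ (2 ^ i <= j)%N, W j <= 2 * W (2 ^ i) &
    forall n, W (2 ^ n * j) <= 2 * W (2 ^ (i + n)) /\ W (2 ^ (i + n)) <= W (2 ^ n * j)].
Proof.
move=> j0; have /andP[ij ji] := trunc_log_bounds (isT : (1 < 2)%N) j0.
exists (trunc_log 2 j); move: (trunc_log 2 j) ij ji => i ij ji; split=> //.
  by apply: le_trans (Wsum_double i); apply: Wsum_homo => //; exact: ltnW.
move=> n; rewrite expnD mulnC; split; last by rewrite Wsum_homo// leq_mul2r ij orbT.
apply: (le_trans _ (WsumM_le _ _ _ _ _)) => //; apply: Wsum_homo => //.
by rewrite mulnA leq_mul2r -expnS ltnW ?orbT.
Qed.

Context (r : R) (r0 : 0 < r).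
(** With r = q/p, the quotient [r / q] compared with the indices is 1/p. *)
Let x := powR 2 (- r).
Let x0 : 0 < x. Proof. exact: powR_gt0. Qed.
Let x1 : x < 1.
Proof.
rewrite /x powRN invf_lt1 ?powR_gt0//.
have {1}<- : powR 1 r = 1 :> R by rewrite powR1.
by apply: gt0_ltr_powR; rewrite ?nnegrE// ltr1n.
Qed.
Let g i := x ^+ i * W (2 ^ i).

Let g0 i : 0 < g i.
Proof. by rewrite mulr_gt0 ?exprn_gt0// Wsum_gt0// expn_gt0. Qed.

Let powXn c (y : R) n : 0 < c -> 0 < y ->
  powR (c * y ^+ n) q^-1 = powR c q^-1 * powR 2 (log2 y / q * n%:R).
Proof.
move=> c0 y0; rewrite powRM ?exprn_ge0 ?ltW//; congr (_ * _).
by rewrite -powR_mulrn ?ltW// -{1}(log2K y0) -!powRrM; congr (powR _ _); ring.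
Qed.

(** By contradiction: if no window works, [geometric_dichotomy] applies, its condition on
    consecutive terms holding because [W] is nondecreasing. Since the ratio [rho] differs from 1,
    either alternative pushes an index strictly past r / q. *)
Lemma dyadic_window (K : R) : 1 < K -> alpha_idx q w <= r / q -> r / q <= beta_idx q w ->
  exists a b, (a < b)%N /\ K * (g a + g b) < \sum_(a <= i < b) g i.
Proof.
move=> K1 alr rbe; apply: contrapT => H.
have gK a b : (a < b)%N -> \sum_(a <= i < b) g i <= K * (g a + g b).
  by move=> ab; rewrite leNgt; apply/negP => h; apply: H; exists a, b.
have gx i : x * g i <= g i.+1.
  rewrite /g exprS mulrA ler_wpM2l ?mulr_ge0 ?exprn_ge0 ?(ltW x0)//.
  by rewrite Wsum_homo// leq_exp2l.
have lx : log2 x = - r by rewrite log2_pow2.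
have x01 : 0 < x <= 1 by rewrite x0 ltW.
have [[c [rho [n0 [c0 rho1 h]]]]|[c [rho [c0 /andP[rho0 rho1] h]]]] :=
  geometric_dichotomy K1 x01 g0 gx gK.
(* Growth of [g] reads W (2^i) <= c^-1 (x / rho)^m W (2^(i+m)), which bounds [A m] from above; the
   factor 2 in the constant is the dyadic rounding. *)
- have rho0 : 0 < rho by lra.
  have lrho : 0 < log2 rho by rewrite divr_gt0 ?ln2_gt0// ln_gt0.
  suff : (r + log2 rho) / q <= alpha_idx q w.
    move/le_trans/(_ alr); rewrite ler_pM2r ?invr_gt0//; lra.
  have c20 : 0 < 2 / c by rewrite divr_gt0.
  apply: (@alpha_ge_of R q w q1 w0 wS (powR (2 / c) q^-1) _ n0); first exact: powR_gt0.
  move=> m nm; have y0 : 0 < x / rho by rewrite divr_gt0.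
  have -> : - ((r + log2 rho) / q) = log2 (x / rho) / q.
    rewrite log2M ?invr_gt0// [log2 rho^-1]/log2 lnV ?posrE// mulNr -/(log2 rho) lx.
    by rewrite -mulNr opprD.
  rewrite -powXn//; apply: Asup_le => //; first by rewrite mulr_gt0 ?exprn_gt0.
  move=> j j0; have [i [ij Wj Wn]] := Wsum_dyadic_bounds j0.
  apply: (le_trans Wj); have [_ Wn2] := Wn m.
  have := h i m nm; rewrite /g exprD => h1.
  have h2 : c * rho ^+ m * W (2 ^ i) <= x ^+ m * W (2 ^ (i + m)).
    by rewrite -(ler_pM2l (exprn_gt0 i x0)) mulrCA [leRHS]mulrA.
  have -> : 2 / c * (x / rho) ^+ m * W (2 ^ m * j) =
      2 * (x ^+ m * W (2 ^ m * j)) / (c * rho ^+ m).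
    by rewrite expr_div_n; field; rewrite expf_neq0 gt_eqF.
  rewrite ler_pdivlMr ?mulr_gt0 ?exprn_gt0// -mulrA ler_pM2l// mulrC.
  by apply: le_trans h2 _; rewrite ler_wpM2l ?exprn_ge0 ?(ltW x0).
(* Decay of [g] bounds W (2^(i+m)) by c (rho / x)^m W (2^i), hence [B m] from above. *)
- have lrho : log2 rho < 0 by rewrite pmulr_llt0 ?invr_gt0 ?ln2_gt0// ln_lt0 ?rho0.
  suff : beta_idx q w <= (r + log2 rho) / q.
    move/(le_trans rbe); rewrite ler_pM2r ?invr_gt0//; lra.
  have c20 : 0 < 2 * c by rewrite mulr_gt0.
  apply: (@beta_le_of R q w q1 w0 wS (powR (2 * c) q^-1) _ 0%N); first exact: powR_gt0.
  move=> m _; have y0 : 0 < rho / x by rewrite divr_gt0.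
  have -> : (r + log2 rho) / q = log2 (rho / x) / q.
    rewrite log2M ?invr_gt0//; congr (_ / _).
    by rewrite [log2 x^-1]/log2 lnV ?posrE// mulNr -/(log2 x) lx opprK addrC.
  rewrite -powXn//; apply: Bsup_le => //; first by rewrite mulr_gt0 ?exprn_gt0.
  move=> j j0; have [i [ij Wj Wn]] := Wsum_dyadic_bounds j0.
  have [Wn1 _] := Wn m; apply: (le_trans Wn1).
  have := h i m; rewrite /g exprD => h1.
  have h2 : x ^+ m * W (2 ^ (i + m)) <= c * rho ^+ m * W (2 ^ i).
    by rewrite -(ler_pM2l (exprn_gt0 i x0)) mulrA [leRHS]mulrCA.
  have Wi : W (2 ^ i) <= W j by exact: Wsum_homo.
  have -> : 2 * c * (rho / x) ^+ m * W j = 2 * (c * rho ^+ m * W j) / x ^+ m.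
    by rewrite expr_div_n; field; rewrite expf_neq0// gt_eqF.
  rewrite ler_pdivlMr ?exprn_gt0// [leLHS](_ : _ = 2 * (x ^+ m * W (2 ^ (i + m)))); last by ring.
  rewrite ler_pM2l//.
  apply: (le_trans h2); rewrite ler_wpM2l// mulr_ge0 ?exprn_ge0//; exact: ltW.
Qed.

(** Counted from 1, this sums k^(-r) w_k^q over M < k <= N. The weights keep their original
    positions; moving the profile to the front is accounted for later. *)
Definition power_mass M N := \sum_(M <= k < N) powR k.+1%:R (- r) * v k.

(** On the dyadic range from 2^i to 2^(i+1) the powers are at least x^(i+1), so the mass there is at
    least g (i+1) - x g i. Summing these turns a dyadic window into one for [power_mass]. *)
Lemma power_mass_window (e : R) : 0 < e ->
  alpha_idx q w <= r / q -> r / q <= beta_idx q w ->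
  exists M N, [/\ (0 < M)%N, (M < N)%N &
    powR M%:R (- r) * W M + powR N%:R (- r) * W N <= e * power_mass M N].
Proof.
move=> e0 alr rbe.
have gE i : powR (2 ^ i)%:R (- r) * W (2 ^ i) = g i.
  rewrite /g /x natrX -!powR_mulrn ?powR_ge0//.
  by rewrite -!powRrM [i%:R * _]mulrC.
(* Chosen so that (1 - x) K = 1/e + 1 + (1 - x): the 1 absorbs the loss -g a from telescoping, and
   the final summand makes K > 1. *)
pose K := (e^-1 + 1) / (1 - x) + 1.
have e'0 : 0 < e^-1 by rewrite invr_gt0.
have K1 : 1 < K by rewrite ltrDr divr_gt0 ?subr_gt0// addr_gt0.
have [a [b [ab hab]]] := dyadic_window K1 alr rbe.
exists (2 ^ a)%N, (2 ^ b)%N; split; rewrite ?expn_gt0 ?ltn_exp2l//.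
rewrite !gE -ler_pdivrMl//.
have Jge c : power_mass (2 ^ a) (2 ^ (a + c)) >=
    (1 - x) * \sum_(a <= i < a + c) g i + g (a + c)%N - g a.
  elim: c => [|c IH].
    by rewrite addn0 /power_mass !big_geq// mulr0 add0r subrr.
  have e1 : (2 ^ a <= 2 ^ (a + c))%N by rewrite leq_exp2l// leq_addr.
  have e2 : (2 ^ (a + c) <= 2 ^ (a + c).+1)%N by rewrite leq_exp2l.
  rewrite addnS [power_mass _ _](@big_cat_nat _ _ _ (2 ^ (a + c)) _ _ _ _ e1 e2)/=.
  rewrite -/(power_mass _ _).
  rewrite big_nat_recr ?leq_addr//=.
  have h : g (a + c).+1 - x * g (a + c)%N <=
      \sum_(2 ^ (a + c) <= i < 2 ^ (a + c).+1) powR i.+1%:R (- r) * v i.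
    have -> : g (a + c).+1 - x * g (a + c)%N =
       \sum_(2 ^ (a + c) <= i < 2 ^ (a + c).+1) x ^+ (a + c).+1 * v i.
      by rewrite -mulr_sumr /g exprS (Wsum_cat e2); ring.
    apply: ler_sum_nat => i /andP[_ i2].
    rewrite ler_wpM2r ?powR_ge0// /x -powR_mulrn ?powR_ge0// -powRrM mulrC powRrM powR_mulrn//.
    rewrite !powRN lef_pV2 ?posrE ?powR_gt0 ?exprn_gt0//.
    by rewrite ge0_ler_powR ?(ltW r0)// ?nnegrE ?exprn_ge0// -natrX ler_nat.
  apply: le_trans (lerD IH h); lra.
have := Jge (b - a)%N; rewrite subnKC 1?ltnW// => /(le_trans _); apply.
have h : (1 - x) * (K * (g a + g b)) <= (1 - x) * \sum_(a <= i < b) g i.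
  by rewrite ler_wpM2l 1?ltW// subr_gt0.
have E : (1 - x) * (K * (g a + g b)) = (e^-1 + 1 + (1 - x)) * (g a + g b).
  by rewrite /K; field; rewrite !gt_eqF// subr_gt0.
have := mulr_ge0 (ltW x0) (ltW (g0 a)); have := g0 a; have := g0 b.
have : 0 < (1 - x) * (g a + g b) by rewrite mulr_gt0 ?subr_gt0 ?addr_gt0.
rewrite E in h; lra.
Qed.

End Window.

(** * Rearrangements and Lorentz norms *)

Section Rearrangement.
Context (R : realType).
Implicit Types (a : nat -> R) (s : R).

Definition few_above a s k : Prop :=
  forall F : seq nat, uniq F -> all (fun i => s < `|a i|) F -> (size F <= k)%N.

(** Every finite family of indices lies in an initial segment, so counts over such segments decide
    the matter. *)
Lemma few_aboveP a s k :
  few_above a s k <-> forall N, (count (fun i => (s < `|a i|)%R) (iota 0 N) <= k)%N.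
Proof.
split=> [h N|h F uF aF].
  rewrite -size_filter; apply: h; first by rewrite filter_uniq ?iota_uniq.
  exact: filter_all.
apply: leq_trans (h (\max_(i <- F) i).+1); rewrite -size_filter uniq_leq_size//.
move=> i iF; rewrite mem_filter (allP aF)// mem_iota/= add0n ltnS.
by rewrite (leq_bigmax_seq _ iF).
Qed.

Lemma decr_ge0 a k : (0 <= decr a k)%E.
Proof. by apply: le_ereal_inf_tmp => _ [s [s0 _] <-]; rewrite lee_fin. Qed.

Lemma decr_le a k s : 0 <= s -> few_above a s k -> (decr a k <= s%:E)%E.
Proof. by move=> s0 h; apply: ereal_inf_lbound; exists s. Qed.

Lemma decr_homo a k l : (k <= l)%N -> (decr a l <= decr a k)%E.
Proof.
move=> kl; apply: ereal_inf_le_tmp => _ [s [s0 h] <-]; exists s => //; split=> //.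
by move=> F uF aF; apply: leq_trans kl; exact: h.
Qed.

Lemma decr_le_count a k s L : (forall i, (L <= i)%N -> a i = 0) -> 0 <= s ->
  (count (fun i => (s < `|a i|)%R) (iota 0 L) <= k)%N -> (decr a k <= s%:E)%E.
Proof.
move=> aL s0 ck; apply: decr_le => // F uF /allP aF.
apply: leq_trans ck; rewrite -size_filter uniq_leq_size// => i iF.
rewrite mem_filter aF// mem_iota/= add0n ltnNge; apply/negP => /aL ai.
by have := aF _ iF; rewrite ai normr0 ltNge s0.
Qed.

(** Nonstrict counts give lower bounds: any competitor t < s in the infimum leaves all these entries
    strictly above t. *)
Lemma decr_ge_count a k s L : (k < count (fun i => (s <= `|a i|)%R) (iota 0 L))%N ->
  (s%:E <= decr a k)%E.
Proof.
move=> kc; apply: le_ereal_inf_tmp => _ [t [t0 /few_aboveP/(_ L) h] <-].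
rewrite lee_fin leNgt; apply/negP => ts; move: kc; rewrite ltnNge => /negP; apply.
by apply: leq_trans h; apply: sub_count => i /= /(lt_le_trans ts).
Qed.

Lemma same_dist_few_above a b s k :
  same_dist a b -> few_above b s k -> few_above a s k.
Proof.
move=> [pi [/bij_inj pi_inj ab]] h F uF aF.
rewrite -(size_map pi) h ?map_inj_uniq// all_map.
by apply: sub_all aF => i /=; rewrite ab.
Qed.

Section Disjoint.
Context (n : nat) (c : 'I_n -> R) (x : 'I_n -> nat -> R).
Context (disj : forall k l, k != l -> forall i, x k i = 0 \/ x l i = 0).

Lemma lincomb_disjoint k i : x k i != 0 -> lincomb c x i = c k * x k i.
Proof.
move=> xk; rewrite /lincomb (bigD1 k)//= big1 ?addr0// => l lk.
by have [->|xk0] := disj lk i; [rewrite mulr0|rewrite xk0 eqxx in xk].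
Qed.

(** At each index at most one term is nonzero, and zeros are not counted because [P] fails at 0; so
    the counted set splits over the summands. *)
Lemma count_lincomb (P : pred R) (F : seq nat) : ~~ P 0 ->
  count (fun i => P (lincomb c x i)) F = (\sum_k count (fun i => P (c k * x k i)%R) F)%N.
Proof.
move=> /negbTE P0; under eq_bigr do rewrite -sum1_count big_mkcond.
rewrite exchange_big -sum1_count big_mkcond/=; apply: eq_bigr => i _.
have [/existsP[k xk]|] := boolP [exists k, x k i != 0].
  rewrite (lincomb_disjoint xk) (bigD1 k)//= big1 ?addn0// => l lk.
  have [->|xk0] := disj lk i; first by rewrite mulr0 P0.
  by rewrite xk0 eqxx in xk.
move=> /existsPn x0; have {}x0 k : x k i = 0 by apply/eqP; rewrite -[_ == _]negbK x0.
by rewrite /lincomb !big1 ?P0// => k _; rewrite x0 mulr0// P0.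
Qed.

End Disjoint.

(** Both infima run over the same levels. If one copy has more than j entries above s then all n do,
    for a total of at least n (j + 1), which exceeds n j + r. *)
Lemma decr_dilation n (x : 'I_n -> nat -> R) (k0 : 'I_n) j r : (r < n)%N ->
  (forall k l, k != l -> forall i, x k i = 0 \/ x l i = 0) ->
  (forall k l, same_dist (x k) (x l)) ->
  decr (lincomb (fun=> 1) x) (n * j + r) = decr (x k0) j.
Proof.
move=> rn disj sd; congr ereal_inf; congr image.
apply/seteqP; split=> s [s0 h]; split => //; last first.
  apply/few_aboveP => N.
  rewrite (@count_lincomb _ (fun=> 1) x disj (fun t => s < `|t|)) ?normr0 -?leNgt//.
  apply: leq_trans (leq_addr _ _); rewrite mulnC.
  rewrite -[n in (_ * n)%N]card_ord mulnC -sum_nat_const leq_sum// => k _.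
  under eq_count do rewrite mul1r.
  by apply/few_aboveP: N; exact: same_dist_few_above (sd k k0) h.
apply: contrapT => nf.
have /choice[N hN] : forall k, exists N, (j < count (fun i => (s < `|x k i|)%R) (iota 0 N))%N.
  move=> k; apply: contrapT => hk; apply: nf.
  apply: same_dist_few_above (sd k0 k) _; apply/few_aboveP => N.
  by rewrite leqNgt; apply/negP => hN; apply: hk; exists N.
move/few_aboveP/(_ (\max_k N k)): h; apply/negP; rewrite -ltnNge.
rewrite (@count_lincomb _ (fun=> 1) x disj (fun t => s < `|t|)) ?normr0 -?leNgt//.
apply: (@leq_trans (n * j.+1)); first by rewrite mulnS addnC ltn_add2r.
rewrite -[n in (n * _)%N]card_ord -sum_nat_const leq_sum// => k _.
under eq_count do rewrite mul1r.
apply: leq_trans (hN k) _.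
by rewrite -(subnKC (leq_bigmax k : (N k <= \max_k N k)%N)) iotaD count_cat leq_addr.
Qed.

End Rearrangement.

Section LorentzNorm.
Context (R : realType) (q : R) (w : nat -> R).
Context (q1 : 1 <= q) (w0 : forall k, 0 < w k) (wS : forall k, w k.+1 <= w k).

Let q0 : 0 < q. Proof. exact: lt_le_trans q1. Qed.
Let qn0 : q != 0. Proof. by rewrite gt_eqF. Qed.
Let q'0 : 0 <= q^-1. Proof. by rewrite invr_ge0 ltW. Qed.
Let q'n0 : q^-1 != 0. Proof. by rewrite invr_eq0. Qed.

Local Notation v k := (powR (w k) q).
Local Notation W := (Wsum q w).

(** An infinite value would make the k-th term of the series infinite, since [w k] is positive. *)
Lemma lambda_decr_fin a k : in_lambda q w a -> decr a k \is a fin_num.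
Proof.
rewrite /in_lambda => /(lty_poweRy q'n0) h.
rewrite ge0_fin_numE ?decr_ge0// ltey; apply/eqP => ak; move: h; apply/negP.
rewrite -leNgt leye_eq; apply/eqP; apply/eqP; rewrite -leye_eq.
apply: le_trans (nneseries_lim_ge k.+1 _); last by move=> *; exact: poweR_ge0.
rewrite big_nat_recr//= ak gt0_mulye ?lte_fin// poweRyr// addey//.
by rewrite -ltNye (lt_le_trans _ (sume_ge0 _ _))// => i _; exact: poweR_ge0.
Qed.

Section RealRearrangement.
Context (a : nat -> R) (y : nat -> R) (ay : forall k, decr a k = (y k)%:E).

Lemma rearr_ge0 k : 0 <= y k.
Proof. by rewrite -lee_fin -ay decr_ge0. Qed.

Lemma rearr_homo k l : (k <= l)%N -> y l <= y k.
Proof. by move=> kl; rewrite -lee_fin -!ay decr_homo. Qed.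

Let S L := \sum_(0 <= k < L) powR (y k) q * v k.

Let S_ge0 L : 0 <= S L.
Proof. by apply: sumr_ge0 => k _; rewrite mulr_ge0 ?powR_ge0. Qed.

Let partialE L : (\sum_(0 <= k < L) poweR (decr a k * (w k)%:E) q = (S L)%:E)%E.
Proof.
rewrite /S -sumEFin; apply: eq_bigr => k _.
by rewrite ay -EFinM poweR_EFin powRM ?rearr_ge0 ?ltW.
Qed.

Lemma lnorm_le C : 0 <= C -> (forall L, S L <= powR C q) -> (lnorm q w a <= C%:E)%E.
Proof.
move=> C0 h.
have -> : C%:E = poweR (powR C q)%:E q^-1.
  by rewrite poweR_EFin -powRrM mulfV// powRr1.
apply: gt0_ler_poweR => //; rewrite ?in_itv/= ?leey ?andbT.
- by apply: nneseries_ge0 => *; exact: poweR_ge0.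
- by rewrite lee_fin powR_ge0.
- apply: lime_le; first by apply: is_cvg_nneseries => *; exact: poweR_ge0.
  by apply: nearW => L; rewrite partialE lee_fin.
Qed.

Lemma lnorm_ge C L : 0 <= C -> powR C q <= S L -> (C%:E <= lnorm q w a)%E.
Proof.
move=> C0 h.
have -> : C%:E = poweR (powR C q)%:E q^-1.
  by rewrite poweR_EFin -powRrM mulfV// powRr1.
apply: gt0_ler_poweR => //; rewrite ?in_itv/= ?leey ?andbT.
- by rewrite lee_fin powR_ge0.
- by apply: nneseries_ge0 => *; exact: poweR_ge0.
- apply: le_trans (nneseries_lim_ge L _); last by move=> *; exact: poweR_ge0.
  by rewrite partialE lee_fin.
Qed.

Lemma partial_le_lnorm C L : 0 <= C -> (lnorm q w a <= C%:E)%E -> S L <= powR C q.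
Proof.
move=> C0 h; have SL := S_ge0 L.
have := @lnorm_ge (powR (S L) q^-1) L (powR_ge0 _ _).
rewrite -powRrM mulVf// powRr1// lexx => /(_ isT)/le_trans/(_ h).
rewrite lee_fin => {}h.
rewrite -(powRr1 SL) -(mulVf qn0) powRrM.
by apply: ge0_ler_powR; rewrite ?nnegrE ?powR_ge0 ?(ltW q0).
Qed.

End RealRearrangement.

(* Summation by parts against the nonincreasing [Y]. *)
Lemma abel_le (Y U V : nat -> R) c K : (forall j, 0 <= Y j) ->
  (forall j, Y j.+1 <= Y j) -> U 0%N = 0 -> V 0%N = 0 -> (forall j, U j <= c * V j) ->
  \sum_(0 <= j < K) Y j * (U j.+1 - U j) <= c * \sum_(0 <= j < K) Y j * (V j.+1 - V j).
Proof.
move=> Y0 YS U0 V0 UV.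
case: K => [|K]; first by rewrite !big_geq// mulr0.
suff : Y K * (c * V K.+1 - U K.+1) <= c * \sum_(0 <= j < K.+1) Y j * (V j.+1 - V j) -
    \sum_(0 <= j < K.+1) Y j * (U j.+1 - U j).
  have : 0 <= Y K * (c * V K.+1 - U K.+1) by rewrite mulr_ge0// subr_ge0.
  lra.
elim: K => [|K IH]; first by rewrite !big_nat1 U0 V0; lra.
rewrite !(big_nat_recr K.+1)//=.
have : Y K.+1 * (c * V K.+1 - U K.+1) <= Y K * (c * V K.+1 - U K.+1).
  by rewrite ler_wpM2r// subr_ge0.
lra.
Qed.

Section Dilation.
Context (a b y : nat -> R) (m : nat).
Context (ay : forall k, decr a k = (y k)%:E).
Context (bay : forall j r, (r < 2 ^ m)%N -> decr b (2 ^ m * j + r) = (y j)%:E).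

Let by_ k : decr b k = (y (k %/ 2 ^ m)%N)%:E.
Proof.
by rewrite {1}(divn_eq k (2 ^ m)) mulnC bay// ltn_mod expn_gt0.
Qed.

(** Each run of 2^m equal values is collected, its weights adding up to an increment of j |-> W (2^m
    * j). This is the form that [abel_le] compares. *)
Let partial_dilation K :
  \sum_(0 <= k < 2 ^ m * K) powR (y (k %/ 2 ^ m)%N) q * v k =
  \sum_(0 <= j < K) powR (y j) q * (W (2 ^ m * j.+1) - W (2 ^ m * j)).
Proof.
rewrite mulnC big_nat_mul; apply: eq_bigr => j _.
rewrite (@Wsum_cat R q w (2 ^ m * j) (2 ^ m * j.+1)) ?leq_mul2l ?leqnSn ?orbT//.
rewrite addrAC subrr add0r mulr_sumr ![(2 ^ m * _)%N]mulnC.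
apply: eq_big_nat => k /andP[k1 k2]; congr (powR (y _) _ * _); apply/eqP.
rewrite eqn_leq -ltnS ltn_divLR ?expn_gt0// k2/=.
by rewrite leq_divRL ?expn_gt0.
Qed.

Let partial_base K :
  \sum_(0 <= k < K) powR (y k) q * v k = \sum_(0 <= j < K) powR (y j) q * (W j.+1 - W j).
Proof. by apply: eq_bigr => j _; rewrite WsumS addrAC subrr add0r. Qed.

Let Yq0 j : 0 <= powR (y j) q. Proof. exact: powR_ge0. Qed.

Let YqS j : powR (y j.+1) q <= powR (y j) q.
Proof.
by apply: ge0_ler_powR; rewrite ?nnegrE ?(rearr_ge0 ay) ?(rearr_homo ay) ?(ltW q0).
Qed.

Lemma lnorm_dilation_le C : 0 <= C -> (lnorm q w a <= C%:E)%E ->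
  (lnorm q w b <= (sup (Bset q w m) * C)%:E)%E.
Proof.
move=> C0 aC; have B0 := le_trans ler01 (Bsup_ge1 q1 w0 wS m).
apply: (lnorm_le by_); first by rewrite mulr_ge0.
(* Enlarging the range to a multiple of 2^m leaves only complete runs. *)
move=> L; apply: (@le_trans _ _ (\sum_(0 <= k < 2 ^ m * L) powR (y (k %/ 2 ^ m)%N) q * v k)).
  rewrite (@big_cat_nat _ _ _ L 0 (2 ^ m * L))//= ?leq_pmull ?expn_gt0//.
  by rewrite lerDl sumr_ge0// => k _; rewrite mulr_ge0 ?powR_ge0.
rewrite partial_dilation powRM//.
apply: (le_trans (@abel_le _ (fun j => W (2 ^ m * j)) W (powR (sup (Bset q w m)) q) L
  Yq0 YqS _ _ _)); rewrite ?muln0 ?Wsum0//.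
  by move=> j; exact: Wsum_Bsup.
by rewrite ler_wpM2l ?powR_ge0// -partial_base (partial_le_lnorm ay).
Qed.

Lemma lnorm_dilation_ge C : 0 <= C -> (lnorm q w b <= C%:E)%E ->
  (lnorm q w a <= (sup (Aset q w m) * C)%:E)%E.
Proof.
move=> C0 bC; have A0 := ltW (Asup_gt0 q1 w0 m).
apply: (lnorm_le ay); first by rewrite mulr_ge0.
move=> L; rewrite partial_base powRM//.
apply: (le_trans (@abel_le _ W (fun j => W (2 ^ m * j)) (powR (sup (Aset q w m)) q) L
  Yq0 YqS _ _ _)); rewrite ?muln0 ?Wsum0//.
  by move=> j; exact: Wsum_Asup.
by rewrite ler_wpM2l ?powR_ge0// -partial_dilation (partial_le_lnorm by_).
Qed.

End Dilation.

(** * Necessity of the index condition *)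

Definition inv_exponent (p : \bar R) : R := if p is r%:E then r^-1 else 0.

Lemma lpnorm_const1 (p : \bar R) n : (0 < n)%N -> (1 <= p)%E ->
  lpnorm p (fun _ : 'I_n => 1) = powR n%:R (inv_exponent p).
Proof.
move=> n0; case: p => [r|_|//] /=.
  by move=> _; rewrite normr1 powR1 sumr_const card_ord.
rewrite powRr0 normr1; apply/le_anti/andP; split.
  by apply: bigmax_le.
by apply: (le_trans _ (le_bigmax _ _ (Ordinal n0))).
Qed.

Lemma lpnorm_delta (p : \bar R) n (k : 'I_n) : (1 <= p)%E ->
  lpnorm p (fun l : 'I_n => (l == k)%:R) = 1.
Proof.
case: p => [r|_|//] /=.
  rewrite lee_fin => r1; have r0 : r != 0 by rewrite gt_eqF// (lt_le_trans _ r1).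
  rewrite (bigD1 k)//= eqxx normr1 powR1 big1 ?addr0 ?powR1// => l /negbTE->.
  by rewrite normr0 powR0.
apply/le_anti/andP; split.
  by apply: bigmax_le => // l _; rewrite ger0_norm ?ler0n// lern1 leq_b1.
by apply: (le_trans _ (le_bigmax _ _ k)); rewrite eqxx normr1.
Qed.

Lemma lincomb_delta n (k : 'I_n) (x : 'I_n -> nat -> R) :
  lincomb (fun l => (l == k)%:R) x = x k.
Proof.
apply/funext => i; rewrite /lincomb (bigD1 k)//= eqxx mul1r big1 ?addr0// => l /negbTE->.
by rewrite mul0r.
Qed.

(** A coordinate vector and the constant vector 1 are the test vectors: they place the norm of one
    copy near 1 and that of the sum of 2^m copies near 2^(m/p), each up to [C]. The dilation bounds
    compare the two, and the resulting factor C^2 vanishes in the limit. *)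
Lemma crude_sym_fin_rep_indices (p : \bar R) : (1 <= p)%E ->
  crude_sym_fin_rep q w p ->
  alpha_idx q w <= inv_exponent p /\ inv_exponent p <= beta_idx q w.
Proof.
move=> p1 [C [C0 hC]].
suff H m : (C ^+ 2)^-1 * powR 2 (- inv_exponent p * m%:R) <= sup (Aset q w m) /\
    (C ^+ 2)^-1 * powR 2 (inv_exponent p * m%:R) <= sup (Bset q w m).
  have c0 : 0 < (C ^+ 2)^-1 by rewrite invr_gt0 exprn_gt0.
  split; first by apply: (alpha_le_of q1 w0 wS c0) => m; exact: (H m).1.
  by apply: (beta_ge_of q1 w0 wS c0) => m; exact: (H m).2.
have P0 : (0 < 2 ^ m)%N by rewrite expn_gt0.
have [x [[xl disj sd] hx]] := hC (2 ^ m)%N.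
pose k0 := Ordinal P0; pose z := lincomb (fun=> 1) x.
have [] := hx (fun l => (l == k0)%:R).
rewrite lincomb_delta lpnorm_delta// !mulr1 => x_ge x_le.
have [] := hx (fun=> 1); rewrite -/z lpnorm_const1//.
have -> : powR (2 ^ m)%:R (inv_exponent p) = powR 2 (inv_exponent p * m%:R) :> R.
  by rewrite natrX -powR_mulrn// -powRrM mulrC.
rewrite mulNr powRN; set T := powR 2 _ => z_ge z_le.
have T0 : 0 < T by exact: powR_gt0.
have ay k : decr (x k0) k = (fine (decr (x k0) k))%:E by rewrite fineK// lambda_decr_fin.
have zy j r : (r < 2 ^ m)%N -> decr z (2 ^ m * j + r) = (fine (decr (x k0) j))%:E.
  by move=> rm; rewrite -ay; exact: decr_dilation.
have C'0 := ltW C0.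
split.
  have := le_trans x_ge (lnorm_dilation_ge ay zy (mulr_ge0 C'0 (ltW T0)) z_le).
  rewrite lee_fin => h.
  have -> : (C ^+ 2)^-1 * T^-1 = C^-1 / (C * T) by field; rewrite !gt_eqF.
  by rewrite ler_pdivrMr ?mulr_gt0.
have := le_trans z_ge (lnorm_dilation_le ay zy C'0 x_le).
rewrite lee_fin => h.
have -> : (C ^+ 2)^-1 * T = C^-1 * T / C by field; rewrite gt_eqF.
by rewrite ler_pdivrMr.
Qed.

End LorentzNorm.

(** * Block systems *)

Section BlockSwap.
Context (R : realType).

Lemma block_interval_mono n (m : nat -> nat) : (forall k, (k < n)%N -> (m k < m k.+1)%N) ->
  forall k l, (k < l)%N -> (l < n)%N -> (m k.+1 <= m l)%N.
Proof.
move=> mS k; elim=> // l IH; rewrite ltnS leq_eqVlt => /predU1P[->//|kl] ln.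
by rewrite (leq_trans (IH kl (ltnW ln)))// ltnW// mS// ltnW.
Qed.

Lemma block_disjoint n (m : nat -> nat) (alpha : nat -> R) :
  (forall k, (k < n)%N -> (m k < m k.+1)%N) ->
  forall k l : 'I_n, k != l -> forall i, block m alpha k i = 0 \/ block m alpha l i = 0.
Proof.
move=> mS k l kl i; rewrite /block; case: ifP => [/andP[k1 k2]|_]; last by left.
right; case: ifP => // /andP[l1 l2]; exfalso; move: kl; rewrite -val_eqE/= neq_ltn.
by move=> /orP[/(block_interval_mono mS)/(_ (ltn_ord l))|
  /(block_interval_mono mS)/(_ (ltn_ord k))] h; lia.
Qed.

Definition perm_nat d (s : {perm 'I_d}) (j : nat) : nat :=
  if insub j is Some o then s o else j.

Lemma perm_nat_lt d (s : {perm 'I_d}) j : (j < d)%N -> (perm_nat s j < d)%N.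
Proof. by move=> jd; rewrite /perm_nat insubT. Qed.

Lemma perm_natE d (s : {perm 'I_d}) j (jd : (j < d)%N) : perm_nat s j = s (Ordinal jd).
Proof. by rewrite /perm_nat insubT. Qed.

Lemma perm_natK d (s : {perm 'I_d}) j : (j < d)%N -> perm_nat s^-1%g (perm_nat s j) = j.
Proof.
by move=> jd; rewrite (perm_natE s jd) /perm_nat valK permK.
Qed.

Lemma perm_natVK d (s : {perm 'I_d}) j : (j < d)%N -> perm_nat s (perm_nat s^-1%g j) = j.
Proof. by move=> jd; rewrite -{1}[s]invgK perm_natK. Qed.

(** Going over by [s] and back by its inverse makes this an involution when the intervals are
    disjoint, which yields the bijectivity demanded by [same_dist]. *)
Definition interval_swap a b d (s : {perm 'I_d}) (i : nat) : nat :=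
  if (a <= i < a + d)%N then (b + perm_nat s (i - a))%N
  else if (b <= i < b + d)%N then (a + perm_nat s^-1%g (i - b))%N else i.

Lemma interval_swap_involutive a b d (s : {perm 'I_d}) :
  (a + d <= b)%N || (b + d <= a)%N -> involutive (interval_swap a b s).
Proof.
move=> dis i; rewrite {2}/interval_swap.
case: ifP => [/andP[i1 i2]|ia].
  have jd : (i - a < d)%N by lia.
  have sd := perm_nat_lt s jd.
  rewrite /interval_swap ifF; last by lia.
  rewrite ifT; last by lia.
  by rewrite addKn perm_natK// subnKC.
case: ifP => [/andP[i1 i2]|ib].
  have jd : (i - b < d)%N by lia.
  have sd := perm_nat_lt s^-1%g jd.
  rewrite /interval_swap ifT; last by lia.
  by rewrite addKn perm_natVK// subnKC.
by rewrite /interval_swap ia ib.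
Qed.

Lemma nth_block_coefs m (alpha : nat -> R) k j : (j < m k.+1 - m k)%N ->
  nth 0 (block_coefs m alpha k) j = alpha (m k + j)%N.
Proof.
by move=> jd; rewrite /block_coefs (nth_map 0%N) ?size_iota// nth_iota.
Qed.

Lemma size_block_coefs m (alpha : nat -> R) k :
  size (block_coefs m alpha k) = (m k.+1 - m k)%N.
Proof. by rewrite /block_coefs size_map size_iota. Qed.

(** A permutation of finitely many coefficients extends to one of all indices by exchanging the two
    intervals; both blocks vanish elsewhere. The reversed order of the coefficient lists makes [s]
    lead from block k to block l. *)
Lemma block_same_dist m (alpha : nat -> R) k l :
  (m k <= m k.+1)%N -> (m l <= m l.+1)%N ->
  (m k.+1 <= m l)%N || (m l.+1 <= m k)%N ->
  same_block_dist (block_coefs m alpha l) (block_coefs m alpha k) ->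
  same_dist (block m alpha k) (block m alpha l).
Proof.
move=> mk ml dis [sz [s hs]].
have dE : (m k.+1 - m k)%N = (m l.+1 - m l)%N by rewrite -!(size_block_coefs _ alpha).
have dE' : size (block_coefs m alpha l) = (m l.+1 - m l)%N by rewrite size_block_coefs.
have Ek : m k.+1 = (m k + (m l.+1 - m l))%N by rewrite -dE subnKC.
have El : m l.+1 = (m l + (m l.+1 - m l))%N by rewrite subnKC.
move: s hs; rewrite dE'; move: (m l.+1 - m l)%N Ek El => d Ek El s hs.
exists (interval_swap (m k) (m l) s); split.
  by apply: inv_bij; apply: interval_swap_involutive; rewrite -Ek -El.
move=> i; rewrite /interval_swap /block Ek El.
case: (boolP (m k <= i < m k + d)%N) => [/andP[i1 i2]|ik].
  have jd : (i - m k < d)%N by lia.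
  have sd := perm_nat_lt s jd.
  rewrite ifT; last by lia.
  have := hs (Ordinal jd).
  by rewrite !nth_block_coefs ?Ek ?El ?addKn//= -perm_natE subnKC.
case: (boolP (m l <= i < m l + d)%N) => [/andP[i1 i2]|/negbTE->//].
have jd : (i - m l < d)%N by lia.
have sd := perm_nat_lt s^-1%g jd.
by rewrite ifF//; lia.
Qed.

End BlockSwap.

Section BlockRepresentation.
Context (R : realType) (q : R) (w : nat -> R).

Lemma sym_block_sym_fin_rep (p : \bar R) : (1 <= p)%E ->
  sym_block_fin_rep q w p -> sym_fin_rep q w p.
Proof.
move=> p1 H n eps eps0; have [m [alpha [m0 mS sbd hn]]] := H n eps eps0.
exists (fun k => block m alpha k); split=> //; split.
(* Membership in the space comes from the upper estimate at a coordinate vector. *)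
- move=> k; have [_] := hn (fun l => (l == k)%:R).
  rewrite (lincomb_delta k (fun k => block m alpha k)) lpnorm_delta// => h.
  by apply: le_lt_trans h _; rewrite ltry.
- exact: block_disjoint.
- move=> k l; have [->|kl] := eqVneq k l; first by exists id; split => //; exists id.
  apply: block_same_dist.
  + exact: ltnW (mS _ (ltn_ord k)).
  + exact: ltnW (mS _ (ltn_ord l)).
  + move: kl; rewrite -val_eqE/= neq_ltn => /orP[kl|lk].
      by rewrite (block_interval_mono mS kl).
    by rewrite (block_interval_mono mS lk) ?orbT.
  + exact: sbd (ltn_ord l) (ltn_ord k).
Qed.

Lemma sym_crude_fin_rep (p : \bar R) : sym_fin_rep q w p -> crude_sym_fin_rep q w p.
Proof.
(* The constant 2 is 1 + eps at eps = 1. *)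
by move=> H; exists (1 + 1); split=> // n; apply: H.
Qed.

End BlockRepresentation.

(** * Consecutive copies of a single profile *)

Section Profile.
Context (R : realType) (n D : nat) (u : nat -> R) (a : 'I_n -> R).
Context (D0 : (0 < D)%N).

Definition profile_block (k : nat) : nat -> R :=
  block (fun k => k * D)%N (fun i => u (i %% D)%N) k.

Definition profile_sum := lincomb a (fun k : 'I_n => profile_block k).

Lemma profile_block_coefs k :
  block_coefs (fun k => k * D)%N (fun i => u (i %% D)%N) k = [seq u d | d <- iota 0 D].
Proof.
have kD : (k.+1 * D - k * D)%N = D by rewrite mulSn addnK.
apply: (@eq_from_nth _ 0); first by rewrite size_block_coefs kD size_map size_iota.
move=> i; rewrite size_block_coefs kD => iD.
rewrite nth_block_coefs ?kD// (nth_map 0%N) ?size_iota// nth_iota//.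
by rewrite modnMDl modn_small.
Qed.

Lemma profile_sum_support i : (n * D <= i)%N -> profile_sum i = 0.
Proof.
move=> ni; rewrite /profile_sum /lincomb big1// => k _.
rewrite /profile_block /block ifF ?mulr0//; apply/negP => /andP[_].
rewrite ltnNge (leq_trans _ ni)// leq_mul2r; apply/orP; right; exact: ltn_ord.
Qed.

Lemma count_profile (P : pred R) : ~~ P 0 ->
  count (fun i => P (profile_sum i)) (iota 0 (n * D)) =
  (\sum_(k < n) count (fun d => P (a k * u d)%R) (iota 0 D))%N.
Proof.
move=> P0; rewrite (count_lincomb a (block_disjoint _ _))//; last first.
  by move=> k _; rewrite ltn_mul2r D0 ltnSn.
apply: eq_bigr => k _.
have kn := ltn_ord k.
(* Cut the range into the indices before, inside and after block k; only the middle piece counts. *)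
have E : (n * D = k * D + (D + (n - k.+1) * D))%N.
  by rewrite -mulSn -mulnDl; congr (_ * _)%N; lia.
rewrite E !iotaD !count_cat add0n.
rewrite (@eq_in_count _ _ pred0 (iota 0 _)); last first.
  move=> i; rewrite mem_iota add0n => /andP[_ ik]; rewrite /block leqNgt ik/=.
  by rewrite mulr0 (negbTE P0).
rewrite count_pred0 add0n [X in (_ + X)%N](_ : _ = 0%N) ?addn0; last first.
  rewrite (@eq_in_count _ _ pred0) ?count_pred0// => i; rewrite mem_iota => /andP[ik _].
  by rewrite /block ifF ?mulr0 ?(negbTE P0)//; apply/negP => /andP[_]; rewrite mulSn addnC; lia.
rewrite -[in LHS](addn0 (k * D)%N) iotaDl count_map; apply: eq_in_count => d.
rewrite mem_iota/= add0n => dD; rewrite /block ifT ?modnMDl ?modn_small//.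
by rewrite leq_addr mulSn addnC ltn_add2r.
Qed.

Lemma decr_profile_le k s : 0 <= s ->
  (\sum_(j < n) count (fun d => (s < `|a j * u d|)%R) (iota 0 D) <= k)%N ->
  (decr profile_sum k <= s%:E)%E.
Proof.
move=> s0 h; apply: (@decr_le_count _ _ _ _ (n * D)) => //.
  exact: profile_sum_support.
by rewrite (@count_profile (fun t => s < `|t|)) ?normr0 -?leNgt.
Qed.

(** The level must be positive, or the zero entries would be counted as well. *)
Lemma decr_profile_ge k s : 0 < s ->
  (k < \sum_(j < n) count (fun d => (s <= `|a j * u d|)%R) (iota 0 D))%N ->
  (s%:E <= decr profile_sum k)%E.
Proof.
move=> s0 h; apply: (@decr_ge_count _ _ _ _ (n * D)).
by rewrite (@count_profile (fun t => s <= `|t|)) ?normr0 -?ltNge.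
Qed.

Lemma decr_profile_eq0 k : (n * D <= k)%N -> (decr profile_sum k <= 0%:E)%E.
Proof.
move=> nk; apply: (@decr_le_count _ _ _ _ (n * D)) => //.
  exact: profile_sum_support.
by apply: leq_trans (count_size _ _) _; rewrite size_iota.
Qed.

End Profile.

Section ProfileNorm.
Context (R : realType) (q : R) (w : nat -> R).
Context (q1 : 1 <= q) (w0 : forall k, 0 < w k) (wS : forall k, w k.+1 <= w k).

Let q0 : 0 < q. Proof. exact: lt_le_trans q1. Qed.

Local Notation v k := (powR (w k) q).
Local Notation W := (Wsum q w).

Lemma sum_support_le (F : nat -> R) X L : (forall k, 0 <= F k) ->
  (forall k, (X <= k)%N -> F k = 0) -> \sum_(0 <= k < L) F k <= \sum_(0 <= k < X) F k.
Proof.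
move=> F0 FX; have [LX|/ltnW XL] := leqP L X.
  by rewrite (big_cat_nat (leq0n L) LX)/= lerDl sumr_ge0.
rewrite (big_cat_nat (leq0n X) XL)/= gerDl big_nat_cond big1// => k.
by rewrite andbT => /andP[/FX].
Qed.

Lemma decr_fin_of_le (b h : nat -> R) : (forall k, (decr b k <= (h k)%:E)%E) ->
  forall k, decr b k = (fine (decr b k))%:E.
Proof.
by move=> bh k; rewrite fineK// ge0_fin_numE ?decr_ge0// (le_lt_trans (bh k)) ?ltry.
Qed.

Lemma lnorm_le_of_decr (b h : nat -> R) C X : 0 <= C ->
  (forall k, (decr b k <= (h k)%:E)%E) -> (forall k, (X <= k)%N -> h k = 0) ->
  \sum_(0 <= k < X) powR (h k) q * v k <= powR C q -> (lnorm q w b <= C%:E)%E.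
Proof.
move=> C0 bh hX hC; have by_ := decr_fin_of_le bh.
have h0 k : 0 <= h k by rewrite -lee_fin (le_trans (decr_ge0 b k) (bh k)).
apply: (lnorm_le q1 w0 by_) => // L; apply: le_trans hC.
apply: (@le_trans _ _ (\sum_(0 <= k < L) powR (h k) q * v k)).
  apply: ler_sum => k _; rewrite ler_wpM2r ?powR_ge0//.
  apply: ge0_ler_powR; rewrite ?nnegrE ?(ltW q0) ?(rearr_ge0 by_)//.
  by rewrite -lee_fin -by_.
apply: sum_support_le => [k|k /hX->]; first by rewrite mulr_ge0 ?powR_ge0.
by rewrite powR0 ?mul0r// gt_eqF.
Qed.

(** The bound [h] ensures that the rearrangement is finite; [l] carries the estimate. *)
Lemma lnorm_ge_of_decr (b h l : nat -> R) C L : 0 <= C ->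
  (forall k, (decr b k <= (h k)%:E)%E) -> (forall k, 0 <= l k) ->
  (forall k, (k < L)%N -> ((l k)%:E <= decr b k)%E) ->
  powR C q <= \sum_(0 <= k < L) powR (l k) q * v k -> (C%:E <= lnorm q w b)%E.
Proof.
move=> C0 bh l0 bl hC; have by_ := decr_fin_of_le bh.
apply: (@lnorm_ge _ _ _ q1 w0 _ _ by_ _ L) => //; apply: (le_trans hC).
apply: ler_sum_nat => k /andP[_ kL]; rewrite ler_wpM2r ?powR_ge0//.
apply: ge0_ler_powR; rewrite ?nnegrE ?(ltW q0) ?(rearr_ge0 by_)//.
by rewrite -lee_fin -by_ bl.
Qed.

Lemma sym_block_of_profile (p : \bar R) :
  (forall n (eps : R), 0 < eps -> exists D u, (0 < D)%N /\
    forall a : 'I_n -> R,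
     (((1 + eps)^-1 * lpnorm p a)%:E <= lnorm q w (profile_sum D u a) /\
      lnorm q w (profile_sum D u a) <= ((1 + eps) * lpnorm p a)%:E)%E) ->
  sym_block_fin_rep q w p.
Proof.
move=> H n eps eps0; have [D [u [D0 h]]] := H n eps eps0.
exists (fun k => k * D)%N, (fun i => u (i %% D)%N); split => //.
- by move=> k _; rewrite ltn_mul2r D0 ltnSn.
- move=> k l _ _; rewrite !profile_block_coefs; split=> //.
  by exists 1%g => i; rewrite perm1.
Qed.

(** As q >= 1, raising 1 + eps to the power q only widens the margin; it is enough to estimate q-th
    powers of norms within 1 + eps. *)
Lemma powR_bracket (eps A : R) : 0 < eps -> 0 <= A ->
  powR ((1 + eps)^-1 * A) q <= (1 + eps)^-1 * powR A q /\
  (1 + eps) * powR A q <= powR ((1 + eps) * A) q.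
Proof.
move=> e0 A0; have e1 : 0 < 1 + eps by lra.
rewrite !powRM ?invr_ge0 ?(ltW e1)//; split; rewrite ler_wpM2r ?powR_ge0//.
  apply: ge1r_powR => //; rewrite invr_gt0 e1 invf_le1//; lra.
by apply: le1r_powR => //; lra.
Qed.

End ProfileNorm.

(** * Power profiles *)

Lemma count_iota_recr (P : pred nat) D :
  count P (iota 0 D.+1) = (count P (iota 0 D) + P D)%N.
Proof. by rewrite -addn1 iotaD count_cat /= addn0. Qed.

Section Counting.
Context (R : realType) (M : nat) (t : R).

Lemma count_lt_le D : 0 <= t ->
  (count (fun d => ((M + d).+1%:R < t)%R) (iota 0 D))%:R <= t.
Proof.
move=> t0; elim: D => [//|D IH].
rewrite count_iota_recr.
case: ltP => [Dt|_]; last by rewrite addn0.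
apply: le_trans (ltW Dt); rewrite ler_nat addn1 ltnS.
by apply: leq_trans (count_size _ _) _; rewrite size_iota leq_addl.
Qed.

Lemma count_le_ge D : t <= (M + D)%:R ->
  t - M.+1%:R <= (count (fun d => ((M + d).+1%:R <= t)%R) (iota 0 D))%:R.
Proof.
move=> tD.
(* Capping t lets the induction on D run without the hypothesis [tD]. *)
suff : Num.min t (M + D).+1%:R - M.+1%:R <=
    (count (fun d => ((M + d).+1%:R <= t)%R) (iota 0 D))%:R.
  by rewrite min_l// (le_trans tD)// ler_nat.
elim: D {tD} => [|D IH]; first by rewrite addn0 subr_le0 ge_min lexx orbT.
rewrite count_iota_recr natrD.
case: (leP (M + D).+1%:R t) => Dt.
  have : Num.min t (M + D.+1).+1%:R <= (M + D).+1%:R + 1.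
    by rewrite ge_min addnS natr1 lexx orbT.
  move: IH; rewrite min_r// [nat_of_bool true]/= => h1 h2; lra.
rewrite addr0; move: IH; rewrite addnS !min_l ?(ltW Dt)//.
by rewrite (le_trans (ltW Dt))// ler_nat.
Qed.

End Counting.

Lemma ler_powR_mono (R : realType) (e x y : R) : 0 < e -> 0 <= x -> 0 <= y ->
  (powR x e <= powR y e) = (x <= y).
Proof.
move=> e0 x0 y0; case: (leP x y) => [xy|yx].
  by apply: ge0_ler_powR; rewrite ?nnegrE ?(ltW e0).
by apply/negbTE; rewrite -ltNge; apply: gt0_ltr_powR; rewrite ?nnegrE.
Qed.

Lemma ltr_powR_mono (R : realType) (e x y : R) : 0 < e -> 0 <= x -> 0 <= y ->
  (powR x e < powR y e) = (x < y).
Proof. by move=> e0 x0 y0; rewrite ltNge ler_powR_mono// -ltNge. Qed.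

Section PowerProfile.
Context (R : realType) (rho : R) (rho1 : 1 <= rho) (n M D : nat) (c : R) (c0 : 0 < c).
Context (a : 'I_n -> R) (D0 : (0 < D)%N).

Let kappa := rho^-1.
Let rho0 : 0 < rho. Proof. exact: lt_le_trans rho1. Qed.
Let kappa0 : 0 < kappa. Proof. by rewrite invr_gt0. Qed.

Definition power_profile (d : nat) : R := c * powR (M + d).+1%:R (- rho^-1).
Definition power_total : R := \sum_(j < n) powR `|a j| rho.
(** For an untruncated profile, entry j exceeds level s while k < t_j (c/s)^rho with t_j =
    |a_j|^rho. These real-valued counts total [tau] exactly at this s. *)
Definition power_level (tau : R) : R := c * powR (power_total / tau) rho^-1.

Local Notation T := power_total.
Local Notation b := (profile_sum D power_profile a).
Let t j := powR `|a j| rho.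

Lemma power_total_ge0 : 0 <= T.
Proof. by apply: sumr_ge0 => j _; exact: powR_ge0. Qed.

Let norm_entry j d :
  `|a j * power_profile d| = c * powR (t j / (M + d).+1%:R) kappa.
Proof.
rewrite normrM /power_profile (ger0_norm (mulr_ge0 (ltW c0) (powR_ge0 _ _))).
rewrite powRM ?invr_ge0 ?powR_ge0// /t -powRrM mulfV ?gt_eqF// powRr1//.
by rewrite powRN -(powR_inv1 (powR_ge0 _ _)) powRAC powR_inv1//; ring.
Qed.

Let level_lt tau j d : 0 < tau ->
  (power_level tau < `|a j * power_profile d|) = (T / tau < t j / (M + d).+1%:R).
Proof.
move=> tau0; rewrite norm_entry ltr_pM2l// ltr_powR_mono// divr_ge0 ?powR_ge0 ?(ltW tau0)//.
exact: power_total_ge0.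
Qed.

Let level_le tau j d : 0 < tau ->
  (power_level tau <= `|a j * power_profile d|) = (T / tau <= t j / (M + d).+1%:R).
Proof.
move=> tau0; rewrite norm_entry ler_pM2l// ler_powR_mono// divr_ge0 ?powR_ge0 ?(ltW tau0)//.
exact: power_total_ge0.
Qed.

Lemma power_level_ge0 tau : 0 <= power_level tau.
Proof. by rewrite mulr_ge0 ?powR_ge0 ?ltW. Qed.

Let t_le j : t j <= T.
Proof. by rewrite /T (bigD1 j)//= lerDl sumr_ge0// => i _; exact: powR_ge0. Qed.

(** Beyond M + 1, copy j contributes at most t_j k / T entries, and these bounds add up to k. For
    smaller k the left cut decides: the largest profile value sits at M + 1 and t_j <= T, so no
    entry exceeds that level. *)
Lemma decr_power_le k : (decr b k <= (power_level (maxn k M.+1)%:R)%:E)%E.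
Proof.
have tau0 : 0 < (maxn k M.+1)%:R :> R by rewrite ltr0n leq_max orbT.
apply: decr_profile_le => //; first exact: power_level_ge0.
under eq_bigr do under eq_count do rewrite level_lt//.
have [T0|T0] := eqVneq T 0.
  rewrite big1// => j _; apply/eqP; rewrite -leqn0 leqNgt -has_count; apply/hasPn => d _.
  have tj : t j = 0 by apply/le_anti; rewrite powR_ge0 andbT -T0 t_le.
  by rewrite T0 tj !mul0r ltxx.
have {}T0 : 0 < T by rewrite lt_neqAle eq_sym T0 power_total_ge0.
have [kM|Mk] := leqP k M.+1.
  rewrite big1// => j _; apply/eqP; rewrite -leqn0 leqNgt -has_count; apply/hasPn => d _.
  rewrite -leNgt.
  apply: ler_pM; rewrite ?powR_ge0 ?invr_ge0 ?t_le//.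
  by rewrite lef_pV2 ?posrE ?ltr0n// ler_nat ltnS leq_addr.
have {}tau0 : 0 < k%:R :> R by rewrite ltr0n (leq_trans _ Mk).
have Tk : T = \sum_j t j by [].
rewrite -(ler_nat R) natr_sum.
rewrite [leRHS](_ : _ = \sum_j (t j / T * k%:R)); last first.
  by rewrite -mulr_suml -mulr_suml -Tk divff ?mul1r// gt_eqF.
apply: ler_sum => j _.
have E d : (T / k%:R < t j / (M + d).+1%:R) = ((M + d).+1%:R < t j / T * k%:R).
  by rewrite ltr_pdivlMr ?ltr0n// mulrAC ltr_pdivrMr// mulrAC ltr_pdivlMr// [T * _]mulrC.
rewrite (eq_count E).
by apply: count_lt_le; rewrite mulr_ge0 ?divr_ge0 ?powR_ge0 ?(ltW T0)// ler0n.
Qed.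

(** The left cut costs each of the n copies at most M + 1 entries, and the shift by [E] compensates
    for all of them. The condition on k.+1 + E keeps the counts clear of the right cut. *)
Lemma decr_power_ge k E : (n * M.+1 <= E)%N -> (k.+1 + E <= M + D)%N ->
  ((power_level (k.+1 + E)%:R)%:E <= decr b k)%E.
Proof.
move=> nE kE; set tau := (k.+1 + E)%:R.
have tau0 : 0 < tau :> R by rewrite ltr0n.
have [T0|T0] := eqVneq T 0.
  by rewrite /power_level T0 mul0r powR0 ?gt_eqF// mulr0 decr_ge0.
have {}T0 : 0 < T by rewrite lt_neqAle eq_sym T0 power_total_ge0.
have Tk : T = \sum_j t j by [].
apply: decr_profile_ge => //; first by rewrite mulr_gt0 ?powR_gt0 ?divr_gt0.
under eq_bigr do under eq_count do rewrite level_le//.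
rewrite -(ler_nat R) natr_sum.
apply: (@le_trans _ _ (\sum_j (t j / T * tau - M.+1%:R))).
  rewrite big_split/= -mulr_suml -mulr_suml -Tk divff ?gt_eqF// mul1r.
  rewrite sumr_const card_ord /tau natrD -mulNrn -mulr_natl.
  by move: nE; rewrite -(ler_nat R) natrM; lra.
apply: ler_sum => j _.
have EE d : (T / tau <= t j / (M + d).+1%:R) = ((M + d).+1%:R <= t j / T * tau).
  by rewrite ler_pdivlMr ?ltr0n// mulrAC ler_pdivrMr// mulrAC ler_pdivlMr// [T * _]mulrC.
rewrite (eq_count EE).
apply: count_le_ge; apply: (@le_trans _ _ tau); last by rewrite ler_nat.
by rewrite ler_piMl ?(ltW tau0)// ler_pdivrMr// mul1r t_le.
Qed.

Lemma powR_power_level q tau : 0 < tau ->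
  powR (power_level tau) q =
  powR c q * powR (powR T rho^-1) q * powR tau (- (q / rho)).
Proof.
move=> tau0; have T0 := power_total_ge0.
rewrite /power_level powRM ?powR_ge0 ?(ltW c0)// -mulrA; congr (_ * _).
rewrite -!powRrM powRM ?invr_ge0 ?(ltW tau0)//; congr (_ * _).
by rewrite -powR_inv1 ?(ltW tau0)// -powRrM; congr powR; ring.
Qed.

End PowerProfile.

Section PowerSums.
Context (R : realType) (q : R) (w : nat -> R) (r : R).
Context (q1 : 1 <= q) (w0 : forall k, 0 < w k) (wS : forall k, w k.+1 <= w k).
Context (r0 : 0 < r) (n M N : nat) (M0 : (0 < M)%N) (MN : (M < N)%N).

Local Notation v k := (powR (w k) q).
Local Notation W := (Wsum q w).
Local Notation P k := (powR k%:R (- r)).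
Local Notation J := (power_mass q w r M N).
Local Notation f k := (P k * W k).

Let P_homo i j : (0 < i)%N -> (i <= j)%N -> P j <= P i :> R.
Proof.
move=> i0 ij; have j0 : (0 < j)%N by exact: leq_trans ij.
rewrite !powRN lef_pV2 ?posrE ?powR_gt0 ?ltr0n//.
by rewrite ge0_ler_powR ?nnegrE ?ler0n ?ler_nat ?(ltW r0).
Qed.

Let sum_le_Wsum (y : R) (F : nat -> R) i j : 0 <= y -> (i <= j)%N ->
  (forall k, (i <= k)%N -> (k < j)%N -> F k <= y) ->
  \sum_(i <= k < j) F k * v k <= y * W j.
Proof.
move=> y0 ij Fy; apply: (@le_trans _ _ (y * \sum_(i <= k < j) v k)).
  by rewrite mulr_sumr; apply: ler_sum_nat => k /andP[ik kj];
    rewrite ler_wpM2r ?powR_ge0 ?Fy.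
by rewrite ler_wpM2l// (Wsum_cat q w ij) lerDr Wsum_ge0.
Qed.

(** Split at M + 1 and N + 1. The flat start costs at most P M * W (M+1), the middle is at most [J]
    after moving each weight one place forward, and the end costs at most P N * W ((n+2) N). *)
Lemma power_sum_upper :
  \sum_(0 <= k < n.+2 * N) P (maxn k M.+1) * v k <= J + 2 * f M + n.+2%:R * f N.
Proof.
have N0 : (0 < N)%N by exact: leq_trans MN.
have MN1 : (M.+1 <= N.+1)%N by rewrite ltnS ltnW.
have NX : (N.+1 <= n.+2 * N)%N by rewrite !mulSn; lia.
rewrite (big_cat_nat (leq0n M.+1) (leq_trans MN1 NX))/= (big_cat_nat MN1 NX)/=.
have S1 : \sum_(0 <= k < M.+1) P (maxn k M.+1) * v k <= P M * W M.+1.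
  apply: sum_le_Wsum; rewrite ?powR_ge0// => k _ _.
  by rewrite P_homo// leq_max leqnSn orbT.
have WM : W M.+1 <= 2 * W M.
  apply: le_trans (WsumM_le q1 w0 wS 2 M); apply: Wsum_homo => //; lia.
have S1' := le_trans S1 (ler_wpM2l (powR_ge0 M%:R (- r)) WM).
have S2 : \sum_(M.+1 <= k < N.+1) P (maxn k M.+1) * v k <= J.
  rewrite big_add1/= /power_mass; apply: ler_sum_nat => k /andP[Mk _].
  rewrite (maxn_idPl _) ?ltnS// ler_wpM2l ?powR_ge0//.
  exact: weight_homo.
have S3 : \sum_(N.+1 <= k < n.+2 * N) P (maxn k M.+1) * v k <= P N * W (n.+2 * N).
  apply: sum_le_Wsum; rewrite ?powR_ge0// => k Nk _.
  by rewrite P_homo// leq_max (ltnW Nk).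
have S3' := le_trans S3 (ler_wpM2l (powR_ge0 N%:R (- r)) (WsumM_le q1 w0 wS n.+2 N)).
lra.
Qed.

(** Undoing the shift by [E] only decreases the weights, after which the sum is [J] without its
    terms below [E]. *)
Lemma power_sum_lower (E := (n.+1 * M.+1)%N) :
  J - (2 * n.+1)%:R * f M <= \sum_(0 <= k < N - E) P (k.+1 + E) * v k.
Proof.
have ME : (M <= E)%N by rewrite /E mulSn; lia.
have shift (F : nat -> R) :
    \sum_(E <= k < N) F k = \sum_(0 <= k < N - E) F (k + E)%N.
  by rewrite -{1}[E]add0n big_addn.
have -> : \sum_(0 <= k < N - E) P (k.+1 + E) * v k =
    \sum_(E <= k < N) P k.+1 * v (k - E)%N.
  by rewrite shift; apply: eq_bigr => k _; rewrite addnK addSn.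
have H1 : \sum_(E <= k < N) P k.+1 * v k <= \sum_(E <= k < N) P k.+1 * v (k - E)%N.
  apply: ler_sum_nat => k _; rewrite ler_wpM2l ?powR_ge0//.
  by apply: weight_homo => //; exact: leq_subr.
apply: le_trans H1.
(* As M >= 1, E = (n+1)(M+1) is at most 2(n+1) M. *)
have WE : P M * W E <= (2 * n.+1)%:R * f M.
  rewrite mulrCA ler_wpM2l ?powR_ge0//.
  apply: le_trans (WsumM_le q1 w0 wS _ _); apply: Wsum_homo => //.
  by rewrite /E -mulnA mulnCA leq_mul2l; lia.
have S1 j : (M <= j)%N -> \sum_(M <= k < j) P k.+1 * v k <= P M * W j.
  move=> Mj; apply: sum_le_Wsum; rewrite ?powR_ge0// => k Mk _.
  by rewrite P_homo// leqW.
have [EN|/ltnW NE] := leqP E N.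
  rewrite /power_mass (big_cat_nat ME EN)/=; have := S1 E ME; lra.
(* The right-hand sum is empty here, but then all of [J] is within the allowed loss. *)
rewrite [leRHS]big_geq//; have := S1 N (ltnW MN).
have := ler_wpM2l (powR_ge0 M%:R (- r)) (Wsum_homo q w0 NE).
rewrite /power_mass; lra.
Qed.

End PowerSums.

(** * Existence of block representations *)

Section Existence.
Context (R : realType) (q : R) (w : nat -> R).
Context (q1 : 1 <= q) (w0 : forall k, 0 < w k) (wS : forall k, w k.+1 <= w k).

Let q0 : 0 < q. Proof. exact: lt_le_trans q1. Qed.

Local Notation v k := (powR (w k) q).
Local Notation W := (Wsum q w).

Lemma power_mass_gt0 r M N : (M < N)%N -> 0 < power_mass q w r M N.
Proof.
move=> MN; rewrite /power_mass big_ltn// ltr_pwDl//.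
  by rewrite mulr_gt0 ?powR_gt0 ?ltr0n.
by apply: sumr_ge0 => k _; rewrite mulr_ge0 ?powR_ge0.
Qed.

Lemma sym_block_fin_rep_finite (rho : R) : 1 <= rho ->
  alpha_idx q w <= rho^-1 -> rho^-1 <= beta_idx q w -> sym_block_fin_rep q w rho%:E.
Proof.
have lower_slack (J eta x y : R) : 0 <= y -> x + y <= eta * J -> (1 - eta) * J <= J - x.
  by move=> y0 h; lra.
have upper_slack (J eta eps x1 x2 x y : R) : x1 <= x -> x2 <= y ->
    x + y <= eta * J -> eta * J <= eps * J -> J + x1 + x2 <= (1 + eps) * J.
  by move=> h1 h2 h3 h4; lra.
move=> rho1 al be; apply: sym_block_of_profile => n eps eps0.
have e1 : 0 < 1 + eps by lra.
have rho0 : 0 < rho by exact: lt_le_trans rho1.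
pose r := q / rho; have r0 : 0 < r by rewrite divr_gt0.
have rq : r / q = rho^-1 by rewrite /r mulrAC mulfV ?mul1r// gt_eqF.
(* One slack for both sides: 1 - eta is exactly 1 / (1 + eps), and eta <= eps. *)
pose eta := eps / (1 + eps).
have eta0 : 0 < eta by rewrite divr_gt0.
have eta_eps : eta <= eps by rewrite ler_pdivrMr ?ler_peMr//; lra.
have eta1 : 1 - eta = (1 + eps)^-1 by rewrite /eta; field; rewrite gt_eqF.
have n0 : 0 < (2 * n.+1)%:R :> R by rewrite ltr0n.
(* Truncation costs at most 2(n+1) times the end values of the window, so the window is sought with
   this much smaller ratio. *)
have e0 : 0 < eta / (2 * n.+1)%:R by rewrite divr_gt0.
have [] := @power_mass_window R q w q1 w0 wS r r0 _ e0; rewrite ?rq//.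
move=> M [N [M0 MN]]; set J := power_mass q w r M N => small.
have J0 : 0 < J by exact: power_mass_gt0.
set fM := _ * W M in small; set fN := _ * W N in small.
have fM0 : 0 <= fM by rewrite mulr_ge0 ?powR_ge0 ?Wsum_ge0.
have fN0 : 0 <= fN by rewrite mulr_ge0 ?powR_ge0 ?Wsum_ge0.
have {small} : (2 * n.+1)%:R * (fM + fN) <= eta * J.
  by move: small; rewrite mulrAC ler_pdivlMr// mulrC.
move=> small.
(* Normalisation: c^q = 1/J cancels the mass. *)
pose c := powR J (- q^-1); have c0 : 0 < c by exact: powR_gt0.
have cq : powR c q = J^-1.
  by rewrite /c -powRrM mulNr mulVf ?gt_eqF// powR_inv1 ?ltW.
have D0 : (0 < N - M)%N by rewrite subn_gt0.
exists (N - M)%N, (power_profile rho M c); split=> // a.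
pose T := power_total rho a.
have -> : lpnorm rho%:E a = powR T rho^-1 by [].
set A := powR T rho^-1; have A0 : 0 <= A by exact: powR_ge0.
have [brl bru] := powR_bracket q1 eps0 A0.
pose E := (n.+1 * M.+1)%N.
have NX : (n * (N - M) <= n.+2 * N)%N.
  by apply: leq_mul; [exact/leqW/leqnSn|exact: leq_subr].
(* The cutoff (n+2) N lies beyond the support length n (N - M) of the sum and matches the range in
   [power_sum_upper]. *)
pose h k := if (k < n.+2 * N)%N then power_level rho c a (maxn k M.+1)%:R else 0.
have bh k : (decr (profile_sum (N - M) (power_profile rho M c) a) k <= (h k)%:E)%E.
  rewrite /h; case: ifPn => [_|]; first exact: decr_power_le.
  by rewrite -leqNgt => Xk; apply: decr_profile_eq0; exact: leq_trans Xk.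
have Aq0 : 0 <= powR A q by exact: powR_ge0.
have levelE k : (0 < k)%N -> powR (power_level rho c a k%:R) q =
    J^-1 * powR A q * powR k%:R (- r).
  by move=> k0; rewrite powR_power_level ?ltr0n// cq.
split.
- apply: (@lnorm_ge_of_decr _ _ _ q1 w0 _ h
    (fun k => power_level rho c a (k.+1 + E)%:R) _ (N - E)) => //.
  + by rewrite mulr_ge0// invr_ge0 ltW.
  + by move=> k; exact: power_level_ge0.
  + move=> k kN; apply: decr_power_ge => //; last first.
      by rewrite subnKC ?(ltnW MN)// addSn addnC -ltn_subRL.
    by rewrite /E mulSn leq_addl.
  apply: (le_trans brl).
  rewrite (_ : \sum_(0 <= k < N - E) _ = J^-1 * powR A q *
      \sum_(0 <= k < N - E) powR (k.+1 + E)%:R (- r) * v k); last first.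
    by rewrite mulr_sumr; apply: eq_bigr => k _; rewrite levelE// mulrA.
  rewrite mulrAC ler_wpM2r// mulrC ler_pdivlMr//.
  have := @power_sum_lower R q w r q1 w0 wS r0 n M N M0 MN.
  rewrite -/J -/fM -/E; apply: le_trans.
  rewrite -eta1; apply: (lower_slack J eta _ ((2 * n.+1)%:R * fN)).
    by rewrite mulr_ge0.
  by rewrite -mulrDr; exact: small.
- apply: (@lnorm_le_of_decr _ _ _ q1 w0 _ h _ (n.+2 * N)) => //.
  + by rewrite mulr_ge0// ltW.
  + by move=> k Xk; rewrite /h ltnNge Xk.
  apply: le_trans bru.
  rewrite (_ : \sum_(0 <= k < n.+2 * N) _ = J^-1 * powR A q *
      \sum_(0 <= k < n.+2 * N) powR (maxn k M.+1)%:R (- r) * v k); last first.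
    rewrite mulr_sumr; apply: eq_big_nat => k /andP[_ kX].
    by rewrite /h kX levelE ?leq_max ?orbT// mulrA.
  rewrite mulrAC ler_wpM2r// mulrC ler_pdivrMr//.
  apply: (le_trans (@power_sum_upper R q w r q1 w0 wS r0 n M N M0 MN)).
  rewrite -/J -/fM -/fN.
  apply: (upper_slack J eta eps (2 * fM) (n.+2%:R * fN)
    ((2 * n.+1)%:R * fM) ((2 * n.+1)%:R * fN)).
  - by rewrite ler_wpM2r// ler_nat leq_pmulr.
  - by rewrite ler_wpM2r// ler_nat mul2n -addnn addSn addnS !ltnS leq_addr.
  - by rewrite -mulrDr; exact: small.
  - by rewrite ler_wpM2r// ltW.
Qed.

(** With alpha = 0 some j has W (2^n * j) close to W j. For constant blocks of length j, normalised
    by W j, the block with the largest coefficient gives the lower bound, and n j <= 2^n j gives the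
    upper one. *)
Lemma sym_block_fin_rep_infinite : alpha_idx q w = 0 -> sym_block_fin_rep q w +oo%E.
Proof.
move=> al; apply: sym_block_of_profile => n eps eps0.
have e1 : 0 < 1 + eps by lra.
have d0 : 0 < 1 - (1 + eps)^-1 by rewrite subr_gt0 invf_lt1//; lra.
have [_ [j /= j0 <-] hz] := sup_adherent d0 (Aset_has_sup q1 w0 n).
have A1 := alpha_eq0 q1 w0 wS n al.
have {hz A1} jA : (1 + eps)^-1 < powR (W j / W (2 ^ n * j)) q^-1.
  by apply: le_lt_trans hz; lra.
have Wj0 := Wsum_gt0 q w0 j0.
pose c := powR (W j) (- q^-1); have c0 : 0 < c by exact: powR_gt0.
have cq : powR c q = (W j)^-1.
  by rewrite /c -powRrM mulNr mulVf ?gt_eqF// powR_inv1 ?ltW.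
exists j, (fun=> c); split=> // a.
pose A := lpnorm +oo%E a; rewrite -/A.
have aA k : `|a k| <= A by exact: le_bigmax.
have A0 : 0 <= A by apply: bigmax_ge_id.
have cA0 : 0 <= c * A by rewrite mulr_ge0// ltW.
pose h k := if (k < n * j)%N then c * A else 0.
have bh k : (decr (profile_sum j (fun=> c) a) k <= (h k)%:E)%E.
  rewrite /h; case: ifPn => [_|]; last by rewrite -leqNgt; exact: decr_profile_eq0.
  apply: decr_profile_le => //.
  rewrite big1// => i _; apply/eqP; rewrite -leqn0 leqNgt -has_count; apply/hasPn => d _.
  by rewrite normrM (gtr0_norm c0) mulrC ltr_pM2r// -leNgt.
have AqE : powR (c * A) q = (W j)^-1 * powR A q by rewrite powRM ?(ltW c0)// cq.
split.
- apply: (@le_trans _ _ A%:E).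
    by rewrite lee_fin ler_piMl// invf_le1//; lra.
  apply: (@lnorm_ge_of_decr _ _ _ q1 w0 _ h (fun=> c * A) _ j) => //.
  + move=> k kj; have [->|An0] := eqVneq A 0; first by rewrite mulr0 decr_ge0.
    have Agt0 : 0 < A by rewrite lt_neqAle eq_sym An0.
    (* If no entry attained the maximum, all would lie strictly below A, and so would their maximum
       because A > 0; the case n = 0 falls under A = 0. *)
    have [i Ai] : exists i, A = `|a i|.
      apply: contrapT => Ai; suff : A < A by rewrite ltxx.
      rewrite {1}/A; apply: bigmax_lt => // i _; rewrite lt_neqAle aA andbT.
      by apply/eqP => ai; apply: Ai; exists i.
    apply: decr_profile_ge => //; first by rewrite mulr_gt0.
    rewrite (bigD1 i)//=; apply: ltn_addr; apply: (leq_trans kj).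
    rewrite (_ : count _ _ = j); first exact: leqnn.
    rewrite -[RHS](size_iota 0); apply/eqP; rewrite -all_count; apply/allP => d _.
    by rewrite normrM (gtr0_norm c0) mulrC ler_pM2r// Ai.
  rewrite -mulr_sumr AqE -/(W j) mulrAC mulVf ?mul1r// gt_eqF//.
- apply: (@lnorm_le_of_decr _ _ _ q1 w0 _ h _ (n * j)) => //.
  + by rewrite mulr_ge0// ltW.
  + by move=> k Xk; rewrite /h ltnNge Xk.
  under eq_big_nat => k /andP[_ kX] do rewrite /h kX AqE.
  rewrite -mulr_sumr -/(W _) mulrAC powRM ?(ltW e1)// ler_wpM2r ?powR_ge0//.
  have Wn0 : 0 < W (2 ^ n * j) by rewrite Wsum_gt0// dyadic_gt0.
  apply: (@le_trans _ _ (W (2 ^ n * j) / W j)).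
    rewrite mulrC ler_wpM2r ?invr_ge0 ?(ltW Wj0)// Wsum_homo//.
    by rewrite leq_mul2r ltnW ?orbT// ltn_expl.
  have : powR (1 + eps)^-1 q <= powR (powR (W j / W (2 ^ n * j)) q^-1) q.
    by apply: ge0_ler_powR; rewrite ?nnegrE ?invr_ge0 ?powR_ge0 ?(ltW q0) ?(ltW e1) ?(ltW jA).
  rewrite -powRrM mulVf ?gt_eqF// powRr1 ?divr_ge0 ?(ltW Wj0) ?(ltW Wn0)//.
  rewrite -powR_inv1 ?(ltW e1)// powRAC powR_inv1 ?powR_ge0//.
  by rewrite -[W j / _]invf_div lef_pV2 ?posrE ?divr_gt0 ?powR_gt0.
Qed.

End Existence.

Theorem theorem6p1 (R : realType) (q : R) (w : nat -> R) (p : \bar R) :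
  1 <= q ->
  (forall k, 0 < w k) ->
  (forall k, w k.+1 <= w k) ->
  (1 <= p)%E ->
  (sym_block_fin_rep q w p <-> sym_fin_rep q w p) /\
  (sym_fin_rep q w p <-> crude_sym_fin_rep q w p) /\
  (crude_sym_fin_rep q w p <->
     (einv (beta_idx q w) <= p /\ p <= einv (alpha_idx q w))%E).
Proof.
move=> q1 w0 wS p1.
have b_s := @sym_block_sym_fin_rep R q w p p1.
have s_c := @sym_crude_fin_rep R q w p.
have c_i : crude_sym_fin_rep q w p ->
    (einv (beta_idx q w) <= p /\ p <= einv (alpha_idx q w))%E.
  move=> /(crude_sym_fin_rep_indices q1 w0 wS p1)[al be]; split; rewrite /einv.
    case: p p1 al be {b_s s_c} => [rho|_ _ _|//] /=; last by rewrite leey.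
    rewrite lee_fin => rho1 _ be; have rho0 : 0 < rho by exact: lt_le_trans rho1.
    (* A finite p forces beta > 0, so [einv] takes its finite value. *)
    have b0 : 0 < beta_idx q w by rewrite (lt_le_trans _ be)// invr_gt0.
    by rewrite gt_eqF// lee_fin -(invrK rho) lef_pV2 ?posrE ?invr_gt0.
  case: eqVneq => [_|an0]; first by rewrite leey.
  have a0 : 0 < alpha_idx q w by rewrite lt_neqAle eq_sym an0 alpha_ge0.
  case: p p1 al be {b_s s_c} => [rho|_|//] /=; last by rewrite leNgt a0.
  rewrite !lee_fin => rho1 al _; have rho0 : 0 < rho by exact: lt_le_trans rho1.
  by rewrite -(invrK rho) lef_pV2 ?posrE ?invr_gt0.
(* This implication closes the cycle of the four conditions. *)
have i_b : (einv (beta_idx q w) <= p /\ p <= einv (alpha_idx q w))%E ->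
    sym_block_fin_rep q w p.
  case: p p1 {b_s s_c c_i} => [rho|_|//] /=; last first.
    move=> [_]; rewrite /einv; case: eqVneq => [al _|//].
    exact: sym_block_fin_rep_infinite.
  rewrite lee_fin => rho1 [be al]; have rho0 : 0 < rho by exact: lt_le_trans rho1.
  apply: sym_block_fin_rep_finite => //.
    move: al; rewrite /einv; case: eqVneq => [-> _|an0]; first by rewrite invr_ge0 ltW.
    have a0 : 0 < alpha_idx q w by rewrite lt_neqAle eq_sym an0 alpha_ge0.
    by rewrite lee_fin => al; rewrite -[leLHS]invrK lef_pV2 ?posrE ?invr_gt0.
  (* If beta were 0, its reciprocal would be infinite and could not lie below the finite p. *)
  move: be; rewrite /einv; case: eqVneq => [//|bn0].
  have b0 : 0 < beta_idx q w by rewrite lt_neqAle eq_sym bn0 beta_ge0.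
  by rewrite lee_fin => be; rewrite -[leRHS]invrK lef_pV2 ?posrE ?invr_gt0.
by tauto.
Qed.
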